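(* Let $(a_\ell,a_r)$ be a two-faced pair in a two-state non-commutative probability space $(\mathcal{A},\varphi,\psi)$. The c-bi-free partial $\mathcal{R}$-transform $\mathcal{R}^{\mathrm{c}}_{(a_\ell,a_r)}$ of $(a_\ell,a_r)$ is given by $$\mathcal{R}^{\mathrm{c}}_{(a_\ell,a_r)}(z,w)=z\mathcal{R}^{\mathrm{c}}_{a_\ell}(z)+w\mathcal{R}^{\mathrm{c}}_{a_r}(w)+\widetilde{\mathcal{R}}^{\mathrm{c}}_{(a_\ell,a_r)}(z,w),$$ where $$\widetilde{\mathcal{R}}^{\mathrm{c}}_{(a_\ell,a_r)}(z,w)=\frac{zw\left(-1+\big(\mathcal{R}_{a_\ell}(z)+\tfrac1z-\mathcal{R}^{\mathrm{c}}_{a_\ell}(z)\big)\big(\mathcal{R}_{a_r}(w)+\tfrac1w-\mathcal{R}^{\mathrm{c}}_{a_r}(w)\big)\,G^\varphi_{(a_\ell,a_r)}\big(\mathcal{R}_{a_\ell}(z)+\tfrac1z,\mathcal{R}_{a_r}(w)+\tfrac1w\big)\right)}{G^\psi_{(a_\ell,a_r)}\big(\mathcal{R}_{a_\ell}(z)+\tfrac1z,\mathcal{R}_{a_r}(w)+\tfrac1w\big)}.$$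
   Context: A two-state non-commutative probability space is a triple $(\mathcal{A},\varphi,\psi)$ with $\mathcal{A}$ a complex unital algebra and $\varphi,\psi$ unital linear functionals on $\mathcal{A}$. A two-faced pair $(a_\ell,a_r)$ is an ordered pair of elements of $\mathcal{A}$ (left variable, right variable). **Bi-non-crossing partitions.** For $\chi:[n]\to\{\ell,r\}$ with $\chi^{-1}(\ell)=\{i_1<\cdots<i_p\}$, $\chi^{-1}(r)=\{i_{p+1}>\cdots>i_n\}$, let $\prec_\chi$ be the total order $i_1\prec_\chi\cdots\prec_\chi i_n$. $\mathcal{BNC}(\chi)$ is the set of partitions of $[n]$ that are non-crossing with respect to $\prec_\chi$. A block $V$ of $\pi\in\mathcal{BNC}(\chi)$ is interior if there is another block $W$ of $\pi$ with $\min_{\prec_\chi}W\prec_\chi\min_{\prec_\chi}V$ and $\max_{\prec_\chi}V\prec_\chi\max_{\prec_\chi}W$; otherwise exterior. **Cumulants.** For $V=\{v_1<\dots<v_m\}$, $(a_1,\dots,a_n)|_V=(a_{v_1},\dots,a_{v_m})$ and $\chi|_V$ is regarded as a map on $[m]$. The $(\ell,r)$-cumulants $\kappa_\chi$ and c-$(\ell,r)$-cumulants $\mathcal{K}_\chi$ are the multilinear functionals on $\mathcal{A}^n$ uniquely determined by $$\psi(a_1\cdots a_n)=\sum_{\pi\in\mathcal{BNC}(\chi)}\prod_{V\in\pi}\kappa_{\chi|_V}((a_1,\dots,a_n)|_V),$$ $$\varphi(a_1\cdots a_n)=\sum_{\pi\in\mathcal{BNC}(\chi)}\prod_{V\text{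 interior}}\kappa_{\chi|_V}((a_1,\dots,a_n)|_V)\prod_{V\text{ exterior}}\mathcal{K}_{\chi|_V}((a_1,\dots,a_n)|_V)$$ for all $n\ge1$, $\chi$, $a_i\in\mathcal{A}$. For $a\in\mathcal{A}$, $\kappa_m(a)=\kappa_\chi(a,\dots,a)$ and $\mathcal{K}_m(a)=\mathcal{K}_\chi(a,\dots,a)$ with $\chi:[m]\to\{\ell,r\}$ constant (free and c-free cumulants). The free and c-free $\mathcal{R}$-transforms are $\mathcal{R}_a(z)=\sum_{m\ge0}\kappa_{m+1}(a)z^m$, $\mathcal{R}^{\mathrm{c}}_a(z)=\sum_{m\ge0}\mathcal{K}_{m+1}(a)z^m$. Let $\chi_{m,n}:[m+n]\to\{\ell,r\}$ with $\chi_{m,n}^{-1}(\ell)=[m]$ and $\mathcal{K}_{m,n}(a_\ell,a_r)=\mathcal{K}_{\chi_{m,n}}(a_\ell,\dots,a_\ell,a_r,\dots,a_r)$ ($m$ copies of $a_\ell$, then $n$ copies of $a_r$). The c-bi-free partial $\mathcal{R}$-transform is $\mathcal{R}^{\mathrm{c}}_{(a_\ell,a_r)}(z,w)=\sum_{m,n\ge0,\,m+n\ge1}\mathcal{K}_{m,n}(a_\ell,a_r)z^mw^n$. The two-variable Cauchy transforms are $$G^\psi_{(a_\ell,a_r)}(z,w)=\frac1{zw}+\sum_{\substack{m,n\ge0\\ m+n\ge1}}\frac{\psi(a_\ell^ma_r^n)}{z^{m+1}w^{n+1}},\qquad G^\varphi_{(a_\ell,a_r)}(z,w)=\frac1{zw}+\sum_{\substack{m,n\ge0\\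 m+n\ge1}}\frac{\varphi(a_\ell^ma_r^n)}{z^{m+1}w^{n+1}}.$$ All series are formal, in two commuting variables; since $(\mathcal{R}_{a}(z)+1/z)^{-1}=z/(1+z\mathcal{R}_a(z))$ is a power series with zero constant term, the substitutions in $G^\varphi,G^\psi$ are well defined formally. *)

(* Defs.v *)
From HB Require Import structures.
From mathcomp Require Import all_boot all_order all_algebra.
From mathcomp Require Import boolp.

Set Implicit Arguments.
Unset Strict Implicit.
Unset Printing Implicit Defensive.

Import GRing.Theory.
Local Open Scope ring_scope.

(** * Formal power series *)

Record fps (R : Type) := Fps { fps_coef : nat -> R }.
Coercion fps_coef : fps >-> Funclass.

Lemma fpsP (R : Type) (f g : fps R) : f =1 g <-> f = g.
Proof.
case: f g => [f] [g]; split=> [/= fg|-> //].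
by congr Fps; apply: funext.
Qed.

HB.instance Definition _ (R : Type) := gen_eqMixin (fps R).
HB.instance Definition _ (R : Type) := gen_choiceMixin (fps R).

Section FpsZmodule.
Variable R : zmodType.

Let add (f g : fps R) := Fps (fun n => f n + g n).
Let opp (f : fps R) := Fps (fun n => - f n).
Let zero : fps R := Fps (fun=> 0).

Let addA : associative add.
Proof. by move=> f g h; apply/fpsP => n /=; rewrite addrA. Qed.
Let addC : commutative add.
Proof. by move=> f g; apply/fpsP => n /=; rewrite addrC. Qed.
Let add0 : left_id zero add.
Proof. by move=> f; apply/fpsP => n /=; rewrite add0r. Qed.
Let addN : left_inverse zero opp add.
Proof. by move=> f; apply/fpsP => n /=; rewrite addNr. Qed.

HB.instance Definition _ := GRing.isZmodule.Build (fps R) addA addC add0 addN.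

Lemma fps0E n : (0 : fps R) n = 0. Proof. by []. Qed.
Lemma fpsDE (f g : fps R) n : (f + g) n = f n + g n. Proof. by []. Qed.
Lemma fpsNE (f : fps R) n : (- f) n = - f n. Proof. by []. Qed.

Lemma fps_sumE I (r : seq I) (P : pred I) (F : I -> fps R) n :
  (\sum_(i <- r | P i) F i) n = \sum_(i <- r | P i) F i n.
Proof. by elim/big_rec2: _ => // i x y _ <-. Qed.

Definition fpsC (c : R) : fps R := Fps (fun n => if n == 0%N then c else 0).

End FpsZmodule.

Section FpsRing.
Variable R : comNzRingType.

Let one : fps R := fpsC 1.
Let mul (f g : fps R) := Fps (fun n => \sum_(i < n.+1) f i * g (n - i)%N).

Let trunc N (f : fps R) := \poly_(i < N.+1) f i.

Let mulE N (f g : fps R) n : (n <= N)%N ->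
  mul f g n = (trunc N f * trunc N g)`_n.
Proof.
move=> nN; rewrite coefM; apply: eq_bigr => i _; rewrite !coef_poly !ltnS.
by rewrite (leq_trans (leq_subr _ _) nN) (leq_trans _ nN) // -ltnS.
Qed.

Let mulC : commutative mul.
Proof. by move=> f g; apply/fpsP => n; rewrite !(mulE _ _ (leqnn n)) mulrC. Qed.

Let mulA : associative mul.
Proof.
suff mulA_l f g h n : mul (mul f g) h n = (trunc n f * trunc n g * trunc n h)`_n.
  move=> f g h; apply/fpsP => n; rewrite mulA_l mulC mulA_l.
  by congr (_`_n); rewrite mulrC mulrA.
rewrite coefM; apply: eq_bigr => i _.
have in_ : (i <= n)%N by rewrite -ltnS.
by rewrite (mulE _ _ in_) coef_poly ltnS leq_subr.
Qed.

Let mul1 : left_id one mul.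
Proof.
move=> f; apply/fpsP => n /=; rewrite big_ord_recl /= mul1r subn0.
by rewrite big1 ?addr0 // => i _; rewrite mul0r.
Qed.

Let mulDl : left_distributive mul +%R.
Proof.
move=> f g h; apply/fpsP => n /=; rewrite -big_split /=.
by apply: eq_bigr => i _; rewrite mulrDl.
Qed.

Let one_neq0 : one != 0.
Proof.
apply/eqP => /fpsP /(_ 0%N) /= /eqP.
by rewrite (negPf (oner_neq0 R)).
Qed.

HB.instance Definition _ :=
  GRing.Zmodule_isComNzRing.Build (fps R) mulA mulC mul1 mulDl one_neq0.

Lemma fps1E n : (1 : fps R) n = if n == 0%N then 1 else 0. Proof. by []. Qed.
Lemma fpsME (f g : fps R) n :
  (f * g) n = \sum_(i < n.+1) f i * g (n - i)%N.
Proof. by []. Qed.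

Definition fpsX : fps R := Fps (fun n => if n == 1%N then 1 else 0).

End FpsRing.

Section FpsUnit.
Variable R : comUnitRingType.
Implicit Types f g : fps R.

Let unit := [pred f : fps R | f 0%N \is a GRing.unit].

Let Fixpoint inv_coefs (f : fps R) (n : nat) {struct n} : seq R :=
  if n is m.+1 then
    let s := inv_coefs f m in
    rcons s (if m is k.+1 then - ((f 0%N)^-1 * \sum_(i < m) f i.+1 * s`_(k - i))
             else (f 0%N)^-1)
  else [::].

Let inv f := if unit f then Fps (fun n => (inv_coefs f n.+1)`_n) else f.

Let size_inv_coefs f n : size (inv_coefs f n) = n.
Proof. by elim: n => //= n IH; rewrite size_rcons IH. Qed.

Let nth_inv_coefs f N n : (n < N)%N -> (inv_coefs f N)`_n = (inv_coefs f n.+1)`_n.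
Proof.
elim: N => // N IH; rewrite ltnS leq_eqVlt => /predU1P[-> //|nN].
by rewrite -IH //= nth_rcons size_inv_coefs nN.
Qed.

Let mulV : {in unit, left_inverse 1 inv *%R}.
Proof.
move=> f /[dup] fu; rewrite inE => f0; apply/fpsP => -[|n].
  by rewrite mulrC fpsME big_ord1 /inv ifT // mulrV.
rewrite mulrC fpsME big_ord_recl /= subn0 {1}/inv ifT //=.
rewrite nth_rcons size_rcons size_inv_coefs ltnn eqxx mulrN mulrA mulrV // mul1r.
apply/eqP; rewrite addrC subr_eq0; apply/eqP; apply: eq_bigr => i _.
rewrite /bump add1n subSS /inv ifT //; congr (_ * _); symmetry.
by apply: (@nth_inv_coefs f n.+1); rewrite ltnS leq_subr.
Qed.

Let unitP f g : g * f = 1 -> unit f.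
Proof.
move/fpsP/(_ 0%N); rewrite fpsME big_ord1 fps1E subn0 => gf.
by apply/unitrP; exists (g 0%N); split=> [|]; last rewrite mulrC; exact: gf.
Qed.

Let invO : {in [predC unit], inv =1 id}.
Proof. by move=> f fu; rewrite /inv ifN. Qed.

HB.instance Definition _ :=
  GRing.ComNzRing_hasMulInverse.Build (fps R) mulV unitP invO.

Lemma fps_unitE f : (f \is a GRing.unit) = (f 0%N \is a GRing.unit).
Proof. by []. Qed.

End FpsUnit.

Section FpsIdomain.
Variable R : idomainType.

Let low (f : fps R) : f != 0 ->
  exists n, f n != 0 /\ forall i, (i < n)%N -> f i = 0.
Proof.
move=> f0; have ex : exists n, f n != 0.
  apply: contrapT => nex; move/eqP: f0; apply; apply/fpsP => n.
  by apply/eqP/negPn/negP => fn; apply: nex; exists n.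
exists (ex_minn ex); case: ex_minnP => m fm min; split=> // i im.
by apply/eqP/negPn/negP => /min; rewrite leqNgt im.
Qed.

Let mul_eq0 : GRing.integral_domain_axiom (fps R).
Proof.
move=> f g fg0; apply/norP => -[/low[m [fm lf]] /low[n [gn lg]]].
move/fpsP/(_ (m + n)%N)/eqP: fg0; apply/negP.
have mi : (m < (m + n).+1)%N by rewrite ltnS leq_addr.
rewrite fpsME (bigD1 (Ordinal mi)) //= addKn big1 ?addr0 ?mulf_neq0 // => i im.
case: (ltngtP i m) => [/lf -> | mi' | eim]; rewrite ?mul0r //; last first.
  by move: im; rewrite -val_eqE /= eim eqxx.
by rewrite lg ?mulr0 // ltn_subLR ?ltn_add2r // -ltnS.
Qed.

HB.instance Definition _ :=
  GRing.ComUnitRing_isIntegral.Build (fps R) mul_eq0.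

End FpsIdomain.

(** * Series in two variables

    [fps (fps K)] is K[[w]][[z]] = K[[z, w]]: the coefficient of z^m w^n of [f]
    is [f m n].  Identities involving 1/z, 1/w and quotients are stated in its
    field of fractions [laurent2]. *)

Notation laurent2 K := {fraction fps (fps K)}.
Notation "f %:F" := (FracField.tofrac f) : ring_scope.

Section TwoVariables.
Variable K : fieldType.

Definition varz : fps (fps K) := fpsX _.
Definition varw : fps (fps K) := fpsC (fpsX _).
Definition in_z (f : fps K) : fps (fps K) := Fps (fun m => fpsC (f m)).
Definition in_w (f : fps K) : fps (fps K) := fpsC f.

(* f(u, v) for u, v without constant term: then u^m v^n has no term of total
   degree less than m + n (subst2_vanish), so the sum over all m, n is finite
   in each degree. *)
Definition subst2 (f u v : fps (fps K)) : fps (fps K) :=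
  Fps (fun i => Fps (fun j =>
    \sum_(m < (i + j).+1) \sum_(n < (i + j).+1) f m n * (u ^+ m * v ^+ n) i j)).

(* The power series equal to x; 0 if there is none. *)
Definition to_fps (x : laurent2 K) : fps (fps K) :=
  if pselect (exists f, f%:F = x) is left ex then projT1 (cid ex) else 0.

(* The value at (x, y) of the series sum_(m, n) g_{m,n} x^(-m) y^(-n); it is
   meaningful when x^-1 and y^-1 are power series without constant term. *)
Definition eval_inv (g : fps (fps K)) (x y : laurent2 K) : laurent2 K :=
  (subst2 g (to_fps x^-1) (to_fps y^-1))%:F.

Lemma tofracK : cancel (fun f => f%:F) to_fps.
Proof.
move=> f; rewrite /to_fps; case: pselect => [ex|[]]; last by exists f.
by case: cid => g /= /eqP; rewrite tofrac_eq => /eqP.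
Qed.

Lemma varz_neq0 : varz != 0.
Proof. by apply/eqP => /fpsP /(_ 1%N) /= /eqP; rewrite oner_eq0. Qed.

Lemma varw_neq0 : varw != 0.
Proof.
apply/eqP => /fpsP /(_ 0%N) /= /fpsP /(_ 1%N) /= /eqP.
by rewrite oner_eq0.
Qed.

Let inv_addV (x f : fps (fps K)) : x != 0 -> 1 + x * f \is a GRing.unit ->
  (f%:F + x%:F^-1)^-1 = (x / (1 + x * f))%:F.
Proof.
move=> x0 u; have tx0 : x%:F != 0 by rewrite tofrac_eq0.
have tu0 : (1 + x * f)%:F != 0.
  by rewrite tofrac_eq0; apply: contraTneq u => ->; rewrite unitr0.
have -> : f%:F + x%:F^-1 = (1 + x * f)%:F / x%:F.
  rewrite tofracD tofrac1 tofracM mulrDl mul1r addrC; congr (_ + _).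
  by rewrite mulrAC divff // mul1r.
rewrite invf_div; apply: (mulIf tu0); rewrite divfK //.
by rewrite -tofracM divrK.
Qed.

Lemma inv_in_z (f : fps K) :
  ((in_z f)%:F + varz%:F^-1)^-1 = (varz / (1 + varz * in_z f))%:F.
Proof.
apply: inv_addV varz_neq0 _; rewrite !fps_unitE fpsDE fpsME big_ord1 /=.
by rewrite ?fps1E ?big_ord1 mul0r addr0 unitr1.
Qed.

Lemma inv_in_w (f : fps K) :
  ((in_w f)%:F + varw%:F^-1)^-1 = (varw / (1 + varw * in_w f))%:F.
Proof.
apply: inv_addV varw_neq0 _; rewrite !fps_unitE fpsDE fpsME big_ord1 /=.
by rewrite ?fps1E ?big_ord1 mul0r addr0 unitr1.
Qed.

Lemma fps2ME (f g : fps (fps K)) i j :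
  (f * g) i j =
  \sum_(a < i.+1) \sum_(b < j.+1) f a b * g (i - a)%N (j - b)%N.
Proof. by rewrite (fpsME f g i) fps_sumE. Qed.

Let ordge k (f : fps (fps K)) := forall i j, (i + j < k)%N -> f i j = 0.

Let ordgeM k l f g : ordge k f -> ordge l g -> ordge (k + l) (f * g).
Proof.
move=> fk gl i j ij; rewrite fps2ME big1 // => -[a /= ai] _.
rewrite big1 // => -[b /= bj] _.
case: (ltnP (a + b) k) => [/fk -> | kab]; first by rewrite mul0r.
rewrite gl ?mulr0 //.
have e : (i + j = (a + b) + ((i - a) + (j - b)))%N.
  by rewrite addnACA !subnKC // -ltnS.
rewrite e in ij; rewrite ltnNge; apply/negP => le.
by move: ij; rewrite ltnNge leq_add.
Qed.

Let ordgeX (f : fps (fps K)) m : f 0%N 0%N = 0 -> ordge m (f ^+ m).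
Proof.
move=> f0; elim: m => [//|m IH]; rewrite exprS -add1n; apply: ordgeM => //.
by move=> [|i] [|j].
Qed.

Lemma subst2_vanish (u v : fps (fps K)) m n i j :
  u 0%N 0%N = 0 -> v 0%N 0%N = 0 -> (i + j < m + n)%N ->
  (u ^+ m * v ^+ n) i j = 0.
Proof. by move=> u0 v0; apply: ordgeM; apply: ordgeX. Qed.

End TwoVariables.

(** * Bi-non-crossing partitions *)

Inductive face := lface | rface.

Section BiNonCrossing.
Variables (n : nat) (chi : {ffun 'I_n -> face}).
Implicit Types (P : {set {set 'I_n}}) (V W : {set 'I_n}) (i j : 'I_n).

(* The strict order in which the left indices come first, increasingly,
   followed by the right indices, decreasingly. *)
Definition prec i j : bool :=
  match chi i, chi j with
  | lface, lface => (i < j)%N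
  | lface, rface => true
  | rface, lface => false
  | rface, rface => (j < i)%N
  end.

Definition crossing V W : bool :=
  [exists i in V, exists j in W, exists k in V, exists l in W,
    [&& prec i j, prec j k & prec k l]].

Definition BNC : {set {set {set 'I_n}}} :=
  [set P : {set {set 'I_n}} | partition P [set: 'I_n] &
    [forall V in P, forall W in P, (V != W) ==> ~~ crossing V W]].

Definition is_min V i : bool := (i \in V) && [forall j in V, (j == i) || prec i j].
Definition is_max V i : bool := (i \in V) && [forall j in V, (j == i) || prec j i].

Definition interior P V : bool :=
  [exists W in P, (W != V) &&
    [exists i, exists j, exists k, exists l,
      [&& is_min W i, is_min V j, is_max V k, is_max W l, prec i j & prec k l]]].

End BiNonCrossing.

(** * Cumulants *)

(* The increasing enumeration of V identifies V with [#|V|]. *)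
Definition restr (T : Type) n (f : {ffun 'I_n -> T}) (V : {set 'I_n}) :
  {ffun 'I_#|V| -> T} := [ffun i => f (enum_val i)].

Section Cumulants.
Variables (K : comNzRingType) (A : algType K).

Definition cumulant_family :=
  forall n, {ffun 'I_n -> face} -> {ffun 'I_n -> A} -> K.

Definition update n (a : {ffun 'I_n -> A}) (i : 'I_n) (x : A) :
  {ffun 'I_n -> A} := [ffun j => if j == i then x else a j].

Definition multilinear n (f : {ffun 'I_n -> A} -> K) : Prop :=
  forall a i (c : K) (x y : A),
    f (update a i (c *: x + y)) = c * f (update a i x) + f (update a i y).

Definition is_lr_cumulants (psi : A -> K) (kappa : cumulant_family) : Prop :=
  (forall n chi, multilinear (@kappa n chi)) /\
  (forall n (chi : {ffun 'I_n -> face}) (a : {ffun 'I_n -> A}), (0 < n)%N ->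
    psi (\prod_(i < n) a i) =
    \sum_(P in BNC chi) \prod_(V in P) kappa #|V| (restr chi V) (restr a V)).

Definition is_c_lr_cumulants (phi : A -> K) (kappa Kc : cumulant_family) : Prop :=
  (forall n chi, multilinear (@Kc n chi)) /\
  (forall n (chi : {ffun 'I_n -> face}) (a : {ffun 'I_n -> A}), (0 < n)%N ->
    phi (\prod_(i < n) a i) =
    \sum_(P in BNC chi)
      ((\prod_(V in P | interior chi P V) kappa #|V| (restr chi V) (restr a V)) *
       (\prod_(V in P | ~~ interior chi P V) Kc #|V| (restr chi V) (restr a V)))).

(* kappa_m(a) and K_m(a); the constant map to [rface] gives the same value
   (lr_cumulants_const, c_lr_cumulants_const). *)
Definition free_cumulant (kappa : cumulant_family) m (a : A) : K :=
  kappa m [ffun=> lface] [ffun=> a].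

Definition chi_mn m n : {ffun 'I_(m + n) -> face} :=
  [ffun i : 'I_(m + n) => if (i < m)%N then lface else rface].

Definition bi_cumulant (Kc : cumulant_family) m n (al ar : A) : K :=
  Kc (m + n)%N (chi_mn m n) [ffun i : 'I_(m + n) => if (i < m)%N then al else ar].

(** ** Transforms *)

(* For kappa this is the free, for K the c-free R-transform. *)
Definition R_transform (kappa : cumulant_family) (a : A) : fps K :=
  Fps (fun m => free_cumulant kappa m.+1 a).

Definition R_transform2 (Kc : cumulant_family) (al ar : A) : fps (fps K) :=
  Fps (fun m => Fps (fun n =>
    if (m + n)%N == 0%N then 0 else bi_cumulant Kc m n al ar)).

(* The two-variable Cauchy transform as a power series in 1/z and 1/w. *)
Definition cauchy_series (xi : A -> K) (al ar : A) : fps (fps K) :=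
  Fps (fun i => Fps (fun j =>
    match i, j with
    | 1%N, 1%N => 1
    | m.+1, n.+1 => xi (al ^+ m * ar ^+ n)
    | _, _ => 0
    end)).

End Cumulants.

Definition cauchy2 (K : fieldType) (A : algType K) (xi : A -> K) (al ar : A) :
  laurent2 K -> laurent2 K -> laurent2 K := eval_inv (cauchy_series xi al ar).

(** ** Existence and uniqueness of the cumulants *)

Section CumulantFacts.
Variables (K : comNzRingType) (A : algType K).
Implicit Types (F G kap : cumulant_family A).

Let blk kap F n (chi : {ffun 'I_n -> face}) P (a : {ffun 'I_n -> A}) V : K :=
  (if interior chi P V then kap else F) #|V| (restr chi V) (restr a V).

Let blkE kap F n (chi : {ffun 'I_n -> face}) (P : {set {set 'I_n}}) (a : {ffun 'I_n -> A}) :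
  \prod_(V in P) blk kap F chi P a V =
  (\prod_(V in P | interior chi P V) kap #|V| (restr chi V) (restr a V)) *
  (\prod_(V in P | ~~ interior chi P V) F #|V| (restr chi V) (restr a V)).
Proof.
rewrite (bigID (interior chi P)) /=; congr (_ * _); apply: eq_bigr => V /andP[_].
  by rewrite /blk => ->.
by rewrite /blk => /negPf->.
Qed.

Let agree n F G := forall m, (0 < m < n)%N -> forall chi a, F m chi a = G m chi a.

Let rest kap F n (chi : {ffun 'I_n -> face}) (a : {ffun 'I_n -> A}) : K :=
  \sum_(P in BNC chi | P != [set [set: 'I_n]]) \prod_(V in P) blk kap F chi P a V.

Let block_card n (chi : {ffun 'I_n -> face}) (P : {set {set 'I_n}}) V :
  P \in BNC chi -> P != [set [set: 'I_n]] -> V \in P -> (0 < #|V| < n)%N.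
Proof.
rewrite inE => /andP[/and3P[_ /trivIsetP tP P0] _] PT VP.
have ne W : W \in P -> W != set0 by move=> WP; apply: contraNneq P0 => <-.
have Vle : (#|V| <= n)%N by have := max_card (mem V); rewrite card_ord.
rewrite card_gt0 ne //= ltn_neqAle Vle andbT.
apply: contraNneq PT => Vn; have VT : V = [set: 'I_n].
  by apply/eqP; rewrite eqEcard subsetT cardsT card_ord /= Vn leqnn.
rewrite eqEsubset sub1set -{2}VT VP andbT; apply/subsetP => W WP; rewrite inE.
apply: contraT => WT; have := tP _ _ WP VP; rewrite VT => /(_ WT).
by rewrite -setI_eq0 setIT (negPf (ne _ WP)).
Qed.

Let rest_agree kap kap' F G n chi a :
  agree n kap kap' -> agree n F G -> @rest kap F n chi a = rest kap' G chi a.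
Proof.
move=> kk FG; apply: eq_bigr => P /andP[PB PT]; apply: eq_bigr => V VP.
have Vn := block_card PB PT VP.
by rewrite /blk; case: ifP => _; [apply: kk | apply: FG].
Qed.

Let restr_setT F n (chi : {ffun 'I_n -> face}) (a : {ffun 'I_n -> A}) :
  F #|[set: 'I_n]| (restr chi setT) (restr a setT) = F n chi a.
Proof.
rewrite /restr; have := @enum_valP _ [set: 'I_n].
have : forall i : 'I_#|[set: 'I_n]|, val (enum_val i) = val i.
  move=> i; rewrite /enum_val enum_setT -enumT; apply: nth_enum_ord.
  by have := ltn_ord i; rewrite {2}cardsT card_ord.
move: (@enum_val _ _) => g; have e : #|[set: 'I_n]| = n by rewrite cardsT card_ord.
move: g; rewrite e => g ge _; congr (F n _ _); apply/ffunP => i; rewrite ffunE.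
  by congr (chi _); apply: val_inj.
by congr (a _); apply: val_inj.
Qed.

Let sum_BNC kap F n (chi : {ffun 'I_n -> face}) (a : {ffun 'I_n -> A}) :
  (0 < n)%N ->
  \sum_(P in BNC chi) \prod_(V in P) blk kap F chi P a V =
  F n chi a + rest kap F chi a.
Proof.
move=> n0; rewrite (bigD1 [set [set: 'I_n]]) /=; last first.
  rewrite inE; apply/andP; split.
    apply/and3P; split; first by rewrite /cover big_set1.
      by apply/trivIsetP => V W /set1P-> /set1P->; rewrite eqxx.
    by rewrite inE eq_sym -card_gt0 cardsT card_ord.
  apply/forall_inP => V /set1P->; apply/forall_inP => W /set1P->.
  by rewrite eqxx.
congr (_ + _); rewrite big_set1 /blk ifN ?restr_setT //.
by apply/exists_inP => -[W /set1P->]; rewrite eqxx.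
Qed.

Let cP phi kap F :
  (forall n (chi : {ffun 'I_n -> face}) (a : {ffun 'I_n -> A}), (0 < n)%N ->
    phi (\prod_(i < n) a i) = F n chi a + rest kap F chi a) <->
  (forall n (chi : {ffun 'I_n -> face}) (a : {ffun 'I_n -> A}), (0 < n)%N ->
    phi (\prod_(i < n) a i) =
    \sum_(P in BNC chi)
      ((\prod_(V in P | interior chi P V) kap #|V| (restr chi V) (restr a V)) *
       (\prod_(V in P | ~~ interior chi P V) F #|V| (restr chi V) (restr a V)))).
Proof.
split=> H n chi a n0; rewrite (H _ chi) // -?sum_BNC //; apply: eq_bigr => P _;
  by rewrite blkE.
Qed.

Let lrE psi kap : is_lr_cumulants psi kap <-> is_c_lr_cumulants psi kap kap.
Proof.
split=> -[ml H]; split=> // n chi a n0; rewrite (H _ chi) //; apply: eq_bigr => P _;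
  by rewrite -blkE; apply: eq_bigr => V _; rewrite /blk; case: ifP.
Qed.

Let unique phi kap kap' F G : (forall n, agree n kap kap' \/ (kap = F /\ kap' = G)) ->
  is_c_lr_cumulants phi kap F -> is_c_lr_cumulants phi kap' G ->
  forall n, agree n F G.
Proof.
move=> kk [_ /cP HF] [_ /cP HG]; elim=> [m|n IH m]; first by rewrite ltn0 andbF.
case/andP=> m0; rewrite ltnS leq_eqVlt => /predU1P[mn | mn]; last by apply: IH; rewrite m0.
subst m => chi a; have := HF _ chi a m0; rewrite (HG _ chi) //.
by rewrite (@rest_agree kap kap' F G) // => [/addIr//|]; case: (kk n) => [//|[-> ->]].
Qed.

Theorem lr_cumulants_unique psi kap kap' :
  is_lr_cumulants psi kap -> is_lr_cumulants psi kap' ->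
  forall n chi a, (0 < n)%N -> kap n chi a = kap' n chi a.
Proof.
move=> /lrE H /lrE H' n chi a n0; apply: (unique _ H H' (n := n.+1)); last by rewrite n0 /=.
by right.
Qed.

Theorem c_lr_cumulants_unique phi kap F G :
  is_c_lr_cumulants phi kap F -> is_c_lr_cumulants phi kap G ->
  forall n chi a, (0 < n)%N -> F n chi a = G n chi a.
Proof.
move=> H H' n chi a n0; apply: (unique _ H H' (n := n.+1)); last by rewrite n0 /=.
by left.
Qed.

Let fixpoint (Phi : cumulant_family A -> cumulant_family A) :
  (forall F G n chi a, agree n F G -> Phi F n chi a = Phi G n chi a) ->
  exists F, forall n chi a, F n chi a = Phi F n chi a.
Proof.
move=> HPhi; pose it k := iter k Phi (fun _ _ _ => 0).
have itE k l n chi a : (n < k)%N -> (n < l)%N -> it k n chi a = it l n chi a.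
  elim: k l n chi a => // k IH [//|l] n chi a nk nl; apply: HPhi => m /andP[_ mn] chi' a'.
  by apply: IH; [apply: leq_trans mn nk | apply: leq_trans mn nl].
exists (fun n => it n.+1 n) => n chi a; apply: HPhi => m /andP[_ mn] chi' a'.
by apply: itE.
Qed.

Let restr_update_out n (a : {ffun 'I_n -> A}) i x (V : {set 'I_n}) :
  i \notin V -> restr (update a i x) V = restr a V.
Proof.
move=> iV; apply/ffunP => j; rewrite !ffunE ifN //.
by apply: contraNneq iV => <-; apply: enum_valP.
Qed.

Let restr_update_in n (a : {ffun 'I_n -> A}) i x (V : {set 'I_n}) (iV : i \in V) :
  restr (update a i x) V = update (restr a V) (enum_rank_in iV i) x.
Proof.
apply/ffunP => j; rewrite !ffunE; congr (if _ then _ else _).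
apply/eqP/eqP => [e|->]; first by rewrite -[X in enum_rank_in _ X]e enum_valK_in.
by rewrite enum_rankK_in.
Qed.

Let rest_multilinear kap F n (chi : {ffun 'I_n -> face}) :
  (forall m chi, (m < n)%N -> multilinear (@kap m chi)) ->
  (forall m chi, (m < n)%N -> multilinear (@F m chi)) ->
  multilinear (@rest kap F n chi).
Proof.
move=> kml Fml a i c x y; rewrite mulr_sumr -big_split /=.
apply: eq_bigr => P /andP[PB PT].
have /and3P[/eqP cP' tP _] : partition P [set: 'I_n] by move: PB; rewrite inE => /andP[].
have iP : i \in cover P by rewrite cP' inE.
have VP := pblock_mem iP; have iV : i \in pblock P i by rewrite mem_pblock.
have /andP[_ Vn] := block_card PB PT VP.
rewrite !(bigD1 _ VP) /= mulrA.
have other z z' : \prod_(V in P | V != pblock P i) blk kap F chi P (update a i z) V =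
                  \prod_(V in P | V != pblock P i) blk kap F chi P (update a i z') V.
  apply: eq_bigr => V /andP[VP' ne]; rewrite /blk !restr_update_out //;
  by apply: contraNN ne => iV'; rewrite (def_pblock tP VP' iV').
rewrite (other x 0) (other y 0) (other _ 0) -mulrDl; congr (_ * _).
rewrite /blk !restr_update_in; case: ifP => _; [exact: kml | exact: Fml].
Qed.

Let moment_multilinear (phi : {scalar A}) n :
  multilinear (fun a : {ffun 'I_n -> A} => phi (\prod_(i < n) a i)).
Proof.
move=> a i c x y; rewrite -linearP; congr (phi _).
have : i \in index_enum 'I_n by rewrite mem_index_enum.
have : uniq (index_enum 'I_n) by rewrite index_enum_uniq.
have off z (s : seq 'I_n) : i \notin s ->
    \prod_(j <- s) update a i z j = \prod_(j <- s) a j.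
  move=> nis; rewrite big_seq [RHS]big_seq; apply: eq_bigr => j js.
  by rewrite ffunE ifN //; apply: contraNneq nis => <-.
elim: (index_enum _) => //= j s IH /andP[js us]; rewrite inE !big_cons.
case: eqVneq => [ij _ | ne /= is_]; last first.
  have uj z : update a i z j = a j by rewrite ffunE ifN 1?eq_sym.
  by rewrite (IH us is_) !uj mulrDr scalerAr.
by subst j; rewrite !off // !ffunE eqxx mulrDl scalerAl.
Qed.

Let solve (phi : {scalar A}) (kapf : cumulant_family A -> cumulant_family A) :
  (forall F G n, agree n F G -> agree n (kapf F) (kapf G)) ->
  (forall F n, (forall m chi, (m < n)%N -> multilinear (@F m chi)) ->
     forall m chi, (m < n)%N -> multilinear (@kapf F m chi)) ->
  exists F, is_c_lr_cumulants phi (kapf F) F.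
Proof.
move=> kag kml.
have [|F HF] := @fixpoint (fun F n chi a => phi (\prod_(i < n) a i) - rest (kapf F) F chi a).
  by move=> F G n chi a FG; congr (_ - _); apply: rest_agree => //; apply: kag.
exists F; split; last by apply/cP => n chi a n0; rewrite HF subrK.
suff ml n : forall m chi, (m < n)%N -> multilinear (@F m chi).
  by move=> n chi; apply: (ml n.+1).
elim: n => // n IH m chi; rewrite ltnS leq_eqVlt => /predU1P[mn | ]; last exact: IH.
subst m => a i c x y; rewrite !HF moment_multilinear rest_multilinear //; last exact: kml.
by rewrite mulrBr opprD addrACA.
Qed.

Theorem lr_cumulants_exist (psi : {scalar A}) : exists kap, is_lr_cumulants psi kap.
Proof. by have [//|//|F /lrE HF] := @solve psi id; exists F. Qed.

Theorem c_lr_cumulants_exist (phi psi : {scalar A}) kap :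
  is_lr_cumulants psi kap -> exists F, is_c_lr_cumulants phi kap F.
Proof. by move=> [ml _]; apply: (@solve phi (fun=> kap)) => // *; apply: ml. Qed.

(** Exchanging left and right reverses the order, hence changes nothing. *)

Let flip s := if s is lface then rface else lface.
Let fl n (chi : {ffun 'I_n -> face}) : {ffun 'I_n -> face} := [ffun i => flip (chi i)].

Let prec_fl n (chi : {ffun 'I_n -> face}) i j : prec (fl chi) i j = prec chi j i.
Proof. by rewrite /prec !ffunE; case: (chi i); case: (chi j). Qed.

Let crossing_fl n (chi : {ffun 'I_n -> face}) V W :
  crossing chi V W -> crossing (fl chi) W V.
Proof.
case/exists_inP=> i iV /exists_inP[j jW] /exists_inP[k kV] /exists_inP[l lW].
case/and3P=> ij jk kl; apply/exists_inP; exists l => //; apply/exists_inP; exists k => //.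
apply/exists_inP; exists j => //; apply/exists_inP; exists i => //.
by rewrite !prec_fl ij jk kl.
Qed.

Let flK n : involutive (@fl n).
Proof. by move=> chi; apply/ffunP => i; rewrite !ffunE; case: (chi i). Qed.

Let BNC_fl n (chi : {ffun 'I_n -> face}) : BNC (fl chi) = BNC chi.
Proof.
suff sub (chi' : {ffun 'I_n -> face}) : BNC chi' \subset BNC (fl chi').
  by apply/eqP; rewrite eqEsubset sub andbT -{2}[chi]flK sub.
apply/subsetP => P; rewrite !inE => /andP[-> /= H].
apply/forall_inP => V VP; apply/forall_inP => W WP; apply/implyP => VW.
move/forall_inP: H => /(_ _ WP) /forall_inP /(_ _ VP) /implyP; rewrite eq_sym => /(_ VW).
by apply: contraNN => /crossing_fl; rewrite flK.
Qed.

Let interior_fl n (chi : {ffun 'I_n -> face}) P V :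
  interior (fl chi) P V = interior chi P V.
Proof.
have min_fl U i : is_min (fl chi) U i = is_max chi U i.
  by rewrite /is_min /is_max; congr (_ && _); apply: eq_forallb => j; rewrite prec_fl.
have max_fl U i : is_max (fl chi) U i = is_min chi U i.
  by rewrite /is_min /is_max; congr (_ && _); apply: eq_forallb => j; rewrite prec_fl.
apply: eq_existsb => W; congr [&& _, _ & _].
apply/existsP/existsP => -[i /existsP[j /existsP[k /existsP[l]]]];
  rewrite ?(min_fl, max_fl, prec_fl) => /and5P[h1 h2 h3 h4 /andP[h5 h6]];
  exists l; apply/existsP; exists k; apply/existsP; exists j; apply/existsP; exists i;
  by rewrite ?(min_fl, max_fl, prec_fl) h1 h2 h3 h4 h5 h6.
Qed.

Let restr_fl n (chi : {ffun 'I_n -> face}) V : restr (fl chi) V = fl (restr chi V).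
Proof. by apply/ffunP => i; rewrite !ffunE. Qed.

Let flf F : cumulant_family A := fun n chi a => F n (fl chi) a.

Let c_fl phi kap F : is_c_lr_cumulants phi kap F ->
  is_c_lr_cumulants phi (flf kap) (flf F).
Proof.
move=> [ml H]; split=> [n chi|n chi a n0]; first exact: ml.
rewrite (H _ (fl chi)) // BNC_fl; apply: eq_bigr => P _.
by congr (_ * _); apply: eq_big => V; rewrite ?interior_fl // restr_fl.
Qed.

Let fl_const n s : fl [ffun=> s] = [ffun=> flip s] :> {ffun 'I_n -> face}.
Proof. by apply/ffunP => i; rewrite !ffunE. Qed.

Let lr_flf psi kap : is_lr_cumulants psi kap -> forall n, agree n kap (flf kap).
Proof.
move=> /lrE H; have H' := c_fl H.
by move=> n m /andP[m0 _] chi a; apply: (lr_cumulants_unique (psi := psi)) => //; apply/lrE.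
Qed.

Theorem lr_cumulants_const psi kap m (a : A) : is_lr_cumulants psi kap -> (0 < m)%N ->
  kap m [ffun=> rface] [ffun=> a] = free_cumulant kap m a.
Proof. by move=> H m0; rewrite (lr_flf H (n := m.+1)) ?m0 ?leqnn // /flf fl_const. Qed.

Theorem c_lr_cumulants_const phi psi kap F m (a : A) :
  is_lr_cumulants psi kap -> is_c_lr_cumulants phi kap F -> (0 < m)%N ->
  F m [ffun=> rface] [ffun=> a] = free_cumulant F m a.
Proof.
move=> Hk HF m0; have ag : forall n, agree n F (flf F).
  by apply: unique HF (c_fl HF) => n; left; apply: lr_flf Hk _.
by rewrite (ag m.+1) ?m0 ?leqnn // /flf fl_const.
Qed.

End CumulantFacts.

(* Main.v *)
Require Import Defs.
From mathcomp Require Import all_boot all_order all_algebra.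
From mathcomp Require Import reals complex.
From mathcomp Require Import ring.

(** In the order [prec] the word a_l^m a_r^n reads as m left points followed by
    n right points, so both moment-cumulant formulas are sums over non-crossing
    partitions of a two-coloured word in which the weight of a block depends
    only on its numbers (p, q) of left and right points.  Scanning the word from
    its first point and recording the block still open there gives, for the
    generating series A_(p,q) of the completions of an exterior block that
    already has p left and q right points,
      A_(p,q)(z,w) = K_(p,q) Phi(z,w) + z M_l(z) A_(p+1,q)(z,w)
                                      + w M(z,w) A_(p,q+1)(0,w),
    where M and Phi are the moment series of psi and phi, and M_l(z) = M(z,0).
    At z -> u = z/(1 + z R_l(z)), w -> v = w/(1 + w R_r(w)) one has
    u M_l(u) = z and v M_r(v) = w, so these recursions become linear with
    multipliers z and w and their unique solution is a power series in the
    cumulants: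
      (1 - u R^c_l(z)) (1 - v R^c_r(w)) Phi(u,v)
        = 1 + u v M(u,v) sum_(m,n) K_(m+1,n+1) z^m w^n. *)

Set Implicit Arguments.
Unset Strict Implicit.
Unset Printing Implicit Defensive.

Import GRing.Theory.
Local Open Scope ring_scope.
Local Open Scope complex_scope.

(** * Sums over partitions *)

Lemma partition_intro (T : finType) (P : {set {set T}}) (S : {set T}) :
  (forall x, x \in S -> exists2 V, V \in P & x \in V) ->
  (forall V, V \in P -> V \subset S) ->
  (forall V W x, V \in P -> W \in P -> x \in V -> x \in W -> V = W) ->
  set0 \notin P -> partition P S.
Proof.
move=> cov sub tri P0; apply/and3P; split=> //.
  rewrite eqEsubset; apply/andP; split; first by apply/bigcupsP => V /sub.
  by apply/subsetP => x /cov[V VP xV]; apply/bigcupP; exists V.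
apply/trivIsetP => V W VP WP; apply: contraNT => /pred0Pn[x /andP[xV xW]].
by apply/eqP; apply: tri VP WP xV xW.
Qed.

Lemma partition_sub (T : finType) (P : {set {set T}}) (S V : {set T}) :
  partition P S -> V \in P -> V \subset S.
Proof.
by move=> PS VP; rewrite -(cover_partition PS); apply: bigcup_max VP _.
Qed.

Lemma partition_block (T : finType) (P : {set {set T}}) (S : {set T}) x :
  partition P S -> x \in S -> exists2 V, V \in P & x \in V.
Proof. by move=> PS; rewrite -(cover_partition PS) => /bigcupP[V]; exists V. Qed.

Lemma partition_eq (T : finType) (P : {set {set T}}) (S V W : {set T}) x :
  partition P S -> V \in P -> W \in P -> x \in V -> x \in W -> V = W.
Proof.
case/and3P=> _ tP _ VP WP xV xW.
by rewrite -(def_pblock tP VP xV) -(def_pblock tP WP xW).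
Qed.

Lemma partition_neq0 (T : finType) (P : {set {set T}}) (S V : {set T}) :
  partition P S -> V \in P -> V != set0.
Proof. by case/and3P=> _ _ P0 VP; apply: contraNneq P0 => <-. Qed.

Lemma partition_set0 (T : finType) (P : {set {set T}}) :
  partition P set0 = (P == set0).
Proof.
apply/idP/eqP => [PS|->].
  apply/setP => V; rewrite inE; apply: contraTF PS => VP; apply/negP => PS.
  move: (partition_neq0 PS VP); rewrite -subset0.
  by rewrite (partition_sub PS VP).
by apply: partition_intro => [x|V|V W x|]; rewrite inE.
Qed.

Lemma partition_set1 (T : finType) (X : {set T}) :
  X != set0 -> partition [set X] X.
Proof.
move=> X0; apply: partition_intro => [x xX|V|V W x|].
- by exists X; rewrite ?inE.
- by rewrite inE => /eqP->.
- by rewrite !inE => /eqP-> /eqP->.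
- by rewrite inE eq_sym.
Qed.

Section SplitSum.
Variables (T : finType) (S1 S2 : {set T}).
Hypothesis S12 : [disjoint S1 & S2].
Implicit Types P : {set {set T}}.

Let split P1 P2 : partition P1 S1 -> partition P2 S2 ->
  ((P1 :|: P2) ::&: S1 = P1) /\ ((P1 :|: P2) ::&: S2 = P2).
Proof.
move=> PS1 PS2; split; apply/setP => V; rewrite !inE.
  have [VP1|_] := boolP (V \in P1); first by rewrite (partition_sub PS1 VP1).
  have [VP2|//] := boolP (V \in P2); apply/negP => /= /subsetP VS1.
  have /set0Pn[x xV] := partition_neq0 PS2 VP2.
  have /subsetP/(_ _ xV) xS2 := partition_sub PS2 VP2.
  by have := disjointFr S12 (VS1 _ xV); rewrite xS2.
have [VP2|_] := boolP (V \in P2).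
  by rewrite (partition_sub PS2 VP2) orbT.
have [VP1|//] := boolP (V \in P1); apply/negP => /= /subsetP VS2.
have /set0Pn[x xV] := partition_neq0 PS1 VP1.
have /subsetP/(_ _ xV) xS1 := partition_sub PS1 VP1.
by have := disjointFr S12 xS1; rewrite VS2.
Qed.

Lemma partitionU P1 P2 :
  partition P1 S1 -> partition P2 S2 -> partition (P1 :|: P2) (S1 :|: S2).
Proof.
move=> PS1 PS2; apply: partition_intro.
- move=> x; rewrite inE => /orP[xS|xS].
    by have [V VP xV] := partition_block PS1 xS; exists V; rewrite // inE VP.
  by have [V VP xV] := partition_block PS2 xS; exists V; rewrite // inE VP orbT.
- move=> V; rewrite inE => /orP[VP|VP].
    by rewrite subsetU // (partition_sub PS1 VP).
  by rewrite subsetU // (partition_sub PS2 VP) orbT.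
- have aux V W x : V \in P1 -> W \in P2 -> x \in V -> x \in W -> V = W.
    move=> VP WP xV xW; have := S12; rewrite disjoint_subset => /subsetP/(_ x).
    rewrite !inE (subsetP (partition_sub PS2 WP)) //.
    by rewrite (subsetP (partition_sub PS1 VP)) // => /(_ isT).
  move=> V W x; rewrite !inE => /orP[VP|VP] /orP[WP|WP] xV xW.
  + exact: partition_eq PS1 VP WP xV xW.
  + exact: aux VP WP xV xW.
  + by rewrite (aux W V x).
  + exact: partition_eq PS2 VP WP xV xW.
- by rewrite inE negb_or; case/and3P: PS1 => _ _ ->; case/and3P: PS2.
Qed.

Let unsplit P : partition P (S1 :|: S2) ->
  (forall V, V \in P -> (V \subset S1) || (V \subset S2)) ->
  [/\ P ::&: S1 :|: P ::&: S2 = P, partition (P ::&: S1) S1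
    & partition (P ::&: S2) S2].
Proof.
move=> PS PV.
have eP : P ::&: S1 :|: P ::&: S2 = P.
  apply/setP => V; rewrite !inE -andb_orr.
  by have [/PV ->|] := boolP (V \in P).
split=> //; apply: partition_intro; rewrite ?inE.
- move=> x xS; have /(partition_block PS)[V VP xV] : x \in S1 :|: S2.
    by rewrite inE xS.
  exists V; rewrite // inE VP /=; case/orP: (PV _ VP) => // /subsetP/(_ _ xV).
  by rewrite (disjointFr S12 xS).
- by move=> V; rewrite inE => /andP[].
- move=> V W x; rewrite !inE => /andP[VP _] /andP[WP _].
  exact: partition_eq PS VP WP.
- by case/and3P: PS => _ _ /negPf->.
- move=> x xS; have /(partition_block PS)[V VP xV] : x \in S1 :|: S2.
    by rewrite inE xS orbT.
  exists V; rewrite // inE VP /=; case/orP: (PV _ VP) => // /subsetP/(_ _ xV).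
  by rewrite (disjointFl S12 xS).
- by move=> V; rewrite inE => /andP[].
- move=> V W x; rewrite !inE => /andP[VP _] /andP[WP _].
  exact: partition_eq PS VP WP.
- by case/and3P: PS => _ _ /negPf->.
Qed.

(** The map sending [P] to the pair [P ::&: S1], [P ::&: S2] is a bijection from the partitions of
    the union without straddling blocks onto pairs of partitions; [split] and [unsplit] are its two
    round trips. The predicates stay abstract because the scan cuts off once a finished block and
    once an enclosed stretch. *)
Lemma sum_partitionU (K : comNzRingType) (Q Q1 Q2 : pred {set {set T}})
    (F F1 F2 : {set {set T}} -> K) :
  (forall P, Q P -> partition P (S1 :|: S2) /\
    forall V, V \in P -> (V \subset S1) || (V \subset S2)) ->
  (forall P, Q1 P -> partition P S1) -> (forall P, Q2 P -> partition P S2) ->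
  (forall P1 P2, partition P1 S1 -> partition P2 S2 ->
    Q (P1 :|: P2) = Q1 P1 && Q2 P2) ->
  (forall P1 P2, Q1 P1 -> Q2 P2 -> F (P1 :|: P2) = F1 P1 * F2 P2) ->
  \sum_(P | Q P) F P = (\sum_(P | Q1 P) F1 P) * (\sum_(P | Q2 P) F2 P).
Proof.
move=> QP Q1P Q2P QU FU; rewrite big_distrl /=.
under [RHS]eq_bigr do rewrite big_distrr /=.
rewrite pair_big /=.
rewrite (reindex_onto (fun p : {set {set T}} * {set {set T}} => p.1 :|: p.2)
  (fun P => (P ::&: S1, P ::&: S2))) /=; last first.
  by move=> P /QP[PS PV]; have [] := unsplit PS PV.
apply: eq_big => [[P1 P2]|[P1 P2] /=].
  rewrite xpair_eqE; apply/idP/idP => /=.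
    case/and3P => QPP /eqP e1 /eqP e2; have [PS PV] := QP _ QPP.
    have [_ PS1 PS2] := unsplit PS PV; rewrite e1 in PS1; rewrite e2 in PS2.
    by rewrite -QU.
  case/andP=> q1 q2; have [-> ->] := split (Q1P _ q1) (Q2P _ q2).
  by rewrite !eqxx andbT QU ?q1 ?q2 ?(Q1P _ q1) ?(Q2P _ q2).
case/andP=> QPP; rewrite xpair_eqE => /andP[/eqP e1 /eqP e2].
have [PS PV] := QP _ QPP.
have [_ PS1 PS2] := unsplit PS PV; rewrite e1 in PS1; rewrite e2 in PS2.
by rewrite QU // in QPP; case/andP: QPP => q1 q2; apply: FU.
Qed.

End SplitSum.

(** * Non-crossing partitions *)

Section NonCrossing.
Variables (n : nat) (chi : {ffun 'I_n -> face}).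
Implicit Types (P : {set {set 'I_n}}) (V W X L S : {set 'I_n}) (i j : 'I_n).

Lemma prec_irr i : prec chi i i = false.
Proof. by rewrite /prec; case: (chi i); rewrite ltnn. Qed.

Lemma prec_trans : transitive (prec chi).
Proof.
move=> j i k; rewrite /prec; case: (chi i); case: (chi j); case: (chi k) => //.
  exact: ltn_trans.
by move=> ji kj; apply: ltn_trans kj ji.
Qed.

Lemma prec_total i j : i != j -> prec chi i j || prec chi j i.
Proof.
rewrite -val_eqE neq_ltn /prec.
by case: (chi i); case: (chi j) => //; rewrite orbC.
Qed.

Definition noncrossing P :=
  [forall V in P, forall W in P, (V != W) ==> ~~ crossing chi V W].

Lemma crossingP V W :
  reflect (exists i j k l, [/\ i \in V, j \in W, k \in V & l \in W] /\
             [/\ prec chi i j, prec chi j k & prec chi k l])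
          (crossing chi V W).
Proof.
apply: (iffP exists_inP) => [[i iV /exists_inP[j jW /exists_inP[k kV]]]|].
  by case/exists_inP=> l lW /and3P[]; exists i, j, k, l.
move=> [i [j [k [l [[iV jW kV lW] [ij jk kl]]]]]]; exists i => //.
apply/exists_inP; exists j => //; apply/exists_inP; exists k => //.
by apply/exists_inP; exists l => //; apply/and3P.
Qed.

Lemma noncrossingP P :
  reflect (forall V W, V \in P -> W \in P -> V != W -> ~ crossing chi V W)
          (noncrossing P).
Proof.
apply: (iffP forall_inP) => [H V W VP WP VW|H V VP].
  by have /forall_inP/(_ W WP)/implyP/(_ VW)/negP := H V VP.
by apply/forall_inP => W WP; apply/implyP => VW; apply/negP; apply: H.
Qed.

Definition ncpart S : pred {set {set 'I_n}} :=
  fun P => partition P S && noncrossing P.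

(** Replaces the comparison of minima and maxima in [interior] by two enclosing points of one block,
    a form that is easy to follow through unions of partitions. *)
Definition covered P V :=
  [exists W in P, exists i in W, exists k in W,
    forall v in V, prec chi i v && prec chi v k].

Lemma coveredP P V :
  reflect (exists W i k, [/\ W \in P, i \in W, k \in W
             & forall v, v \in V -> prec chi i v /\ prec chi v k])
          (covered P V).
Proof.
apply: (iffP exists_inP) => [[W WP /exists_inP[i iW /exists_inP[k kW]]]|].
  by move=> /forall_inP H; exists W, i, k; split=> // v /H/andP[].
move=> [W [i [k [WP iW kW H]]]]; exists W => //; apply/exists_inP; exists i => //.
by apply/exists_inP; exists k => //; apply/forall_inP => v /H[-> ->].
Qed.

(** An element with the fewest predecessors inside [V] is minimal, since any predecessor of it would
    have strictly fewer. *)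
Lemma prec_min V : V != set0 -> exists i, is_min chi V i.
Proof.
case/set0Pn=> x xV.
pose r i := #|[set j in V | prec chi j i]|.
case: (@arg_minnP _ x (mem V) r xV) => i /= iV Hi; exists i.
rewrite /is_min iV; apply/forall_inP => j jV; have [//|ne /=] := eqVneq.
have /orP[ji|//] := prec_total ne.
have := Hi j jV; rewrite leqNgt => /negP[]; apply: proper_card.
apply/properP; split; first apply/subsetP => k; rewrite ?inE.
  by case/andP=> -> /= kj; apply: prec_trans kj ji.
by exists j; rewrite !inE jV // prec_irr.
Qed.

Lemma prec_max V : V != set0 -> exists i, is_max chi V i.
Proof.
case/set0Pn=> x xV.
pose r i := #|[set j in V | prec chi i j]|.
case: (@arg_minnP _ x (mem V) r xV) => i /= iV Hi; exists i.
rewrite /is_max iV; apply/forall_inP => j jV; have [//|ne /=] := eqVneq.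
have /orP[//|ij] := prec_total ne.
have := Hi j jV; rewrite leqNgt => /negP[]; apply: proper_card.
apply/properP; split; first apply/subsetP => k; rewrite ?inE.
  by case/andP=> -> /= kj; apply: prec_trans ij kj.
by exists j; rewrite !inE jV // prec_irr.
Qed.

(** The extremal points of [W] enclose [V] by transitivity. Conversely, two enclosing points of [W]
    bound its extremal points, which exist because blocks are nonempty. *)
Lemma interiorE P S V : partition P S -> V \in P -> interior chi P V = covered P V.
Proof.
move=> PS VP; apply/exists_inP/coveredP.
  move=> [W WP /andP[_ /existsP[i /existsP[j /existsP[k /existsP[l]]]]]].
  case/and5P=> /andP[iW _] /andP[jV /forall_inP jm] /andP[kV /forall_inP km].
  case/andP=> lW _ /andP[ij kl]; exists W, i, l; split=> // v vV; split.
    have /orP[/eqP->//|] := jm v vV; exact: prec_trans.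
  have /orP[/eqP->//|vk] := km v vV; exact: prec_trans vk kl.
move=> [W [i [k [WP iW kW H]]]]; exists W => //; apply/andP; split.
  by apply: contraTneq iW => ->; apply/negP => /H[]; rewrite prec_irr.
have V0 := partition_neq0 PS VP; have W0 := partition_neq0 PS WP.
have [[a am] [b bm]] := (prec_min W0, prec_max W0).
have [[c cm] [d dm]] := (prec_min V0, prec_max V0).
apply/existsP; exists a; apply/existsP; exists c; apply/existsP; exists d.
apply/existsP; exists b; rewrite am cm dm bm /=.
case/andP: cm => /H[ic _] _; case/andP: dm => /H[_ dk] _.
case/andP: am => _ /forall_inP/(_ _ iW) ai; case/andP: bm => _ /forall_inP/(_ _ kW) kb.
apply/andP; split; first by case/predU1P: ai => [<-//|]; move/prec_trans; apply.
case/predU1P: kb => [<-//|]; exact: prec_trans.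
Qed.

(** Asymmetric on purpose: a block inside [L] can then neither cross nor cover a block inside [S],
    whereas a block inside [S] may still cover one inside [L], as the open block does with a stretch
    that it encloses. *)
Definition unsplit_by L S :=
  forall i k x, i \in L -> k \in L -> x \in S -> prec chi i x -> prec chi x k -> False.

Section Union.
Variables (L S : {set 'I_n}) (P1 P2 : {set {set 'I_n}}).
Hypotheses (LS : unsplit_by L S) (P1L : partition P1 L) (P2S : partition P2 S).

Let sub1 V x : V \in P1 -> x \in V -> x \in L.
Proof. by move=> /(partition_sub P1L)/subsetP; apply. Qed.

Let sub2 V x : V \in P2 -> x \in V -> x \in S.
Proof. by move=> /(partition_sub P2S)/subsetP; apply. Qed.

(** In a crossing each of the two blocks has a point strictly between two points of the other, so a
    crossing between a block in [L] and one in [S] contradicts [unsplit_by]. *)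
Lemma noncrossingU : noncrossing (P1 :|: P2) = noncrossing P1 && noncrossing P2.
Proof.
apply/noncrossingP/andP => [H|[/noncrossingP H1 /noncrossingP H2] V W].
  by split; apply/noncrossingP => V W VP WP; apply: H; rewrite inE ?VP ?WP ?orbT.
rewrite !inE => /orP[VP|VP] /orP[WP|WP]; [exact: H1| | |exact: H2].
  move=> _ /crossingP[i [j [k [l [[iV jW kV lW] [ij jk kl]]]]]].
  exact: (LS (sub1 VP iV) (sub1 VP kV) (sub2 WP jW)).
move=> _ /crossingP[i [j [k [l [[iV jW kV lW] [ij jk kl]]]]]].
exact: (LS (sub1 WP jW) (sub1 WP lW) (sub2 VP kV)).
Qed.

Lemma coveredUr V : V \in P2 -> covered (P1 :|: P2) V = covered P2 V.
Proof.
move=> VP; apply/coveredP/coveredP => -[W [i [k [WP iW kW H]]]]; last first.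
  by exists W, i, k; rewrite inE WP orbT.
move: WP; rewrite inE => /orP[WP|WP]; last by exists W, i, k.
have /set0Pn[v vV] := partition_neq0 P2S VP; have [iv vk] := H _ vV.
by case: (LS (sub1 WP iW) (sub1 WP kW) (sub2 VP vV)).
Qed.

End Union.

End NonCrossing.

(** * Weighted sums over non-crossing partitions *)

Section PartitionSums.
Variables (K : comNzRingType) (n : nat) (chi : {ffun 'I_n -> face}).
Variables f g : {set 'I_n} -> K.
Implicit Types (P : {set {set 'I_n}}) (V W X L S : {set 'I_n}) (i j : 'I_n).

(** With [f] and [g] the cumulants of psi and the c-cumulants this is the summand for phi; with [f]
    in both places it is the summand for psi. *)
Definition weight P := \prod_(V in P) (if covered chi P V then f V else g V).

Definition ncsum S := \sum_(P | ncpart chi S P) weight P.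

Definition open_at X L P := [exists B in P, (X \subset B) && [disjoint B & L]].

(* A state of the scan: [X] is the known part of the open block, [L] the
   stretch passed since its last point, [S] what remains. *)
Definition opensum X L S :=
  \sum_(P | ncpart chi (X :|: L :|: S) P && open_at X L P) weight P.

Definition before X S := forall x y, x \in X -> y \in S -> prec chi x y.

Lemma before_disjoint X S : before X S -> [disjoint X & S].
Proof.
move=> XS; rewrite -setI_eq0; apply/eqP/setP => x; rewrite !inE.
by apply/negP => /andP[xX xS]; have := XS _ _ xX xS; rewrite prec_irr.
Qed.

Lemma prec_asym i j : prec chi i j -> prec chi j i -> False.
Proof. by move=> ij /(prec_trans ij); rewrite prec_irr. Qed.

Lemma ncsum0 : ncsum set0 = 1.
Proof.
rewrite /ncsum (big_pred1 set0); first by rewrite /weight big_set0.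
move=> P; rewrite /= /ncpart partition_set0; case: eqP => [->/=|//].
by apply/noncrossingP => V W; rewrite inE.
Qed.

Lemma open_atP X L P :
  reflect (exists B, [/\ B \in P, X \subset B & [disjoint B & L]]) (open_at X L P).
Proof.
apply: (iffP exists_inP) => [[B BP /andP[]]|[B []]]; first by exists B.
by move=> BP XB BL; exists B; rewrite // XB.
Qed.

(** Start of the scan: the block of [c] is the open one and nothing has been passed yet. *)
Lemma ncsum_open S c : c \in S -> ncsum S = opensum [set c] set0 (S :\ c).
Proof.
move=> cS; apply: eq_bigl => P.
rewrite setU0 setD1K //; apply/esym/andb_idr => /andP[PS _].
have [V VP cV] := partition_block PS cS; apply/open_atP; exists V.
by rewrite sub1set disjoints_subset setC0 subsetT.
Qed.

(** End of the scan: with no point left the open block is exactly [X]. Since [X] precedes [L], it is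
    uncovered, and it neither crosses nor covers a block inside [L]; what remains is an arbitrary
    non-crossing partition of [L]. *)
Lemma opensum_close X L : X != set0 -> before X L ->
  opensum X L set0 = g X * ncsum L.
Proof.
move=> X0 XL; have dXL := before_disjoint XL.
have uXL : unsplit_by chi X L.
  by move=> i k x iX kX xL ix xk; apply: prec_asym xk (XL _ _ kX xL).
(* Written as a sum over the one-block partition of [X], so that [sum_partitionU] applies. *)
have -> : g X = \sum_(P | P == [set X]) g X by rewrite big_pred1_eq.
rewrite /opensum setU0; apply: (sum_partitionU dXL).
- move=> P /andP[/andP[PS _] /open_atP[B [BP XB BL]]]; split=> // V VP.
  have eB : B = X.
    apply/eqP; rewrite eqEsubset XB andbT; apply/subsetP => x xB.
    have := subsetP (partition_sub PS BP) x xB; rewrite inE => /orP[//|xL].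
    by rewrite (disjointFr BL xB) in xL.
  subst B; have [->|ne] := eqVneq V X; first by rewrite subxx.
  apply/orP; right; apply/subsetP => x xV.
  have := subsetP (partition_sub PS VP) x xV; rewrite inE => /orP[xX|//].
  by rewrite (partition_eq PS VP BP xV xX) eqxx in ne.
- by move=> P /eqP->; apply: partition_set1.
- by move=> P /andP[].
- move=> P1 P2 PS1 PS2; rewrite /ncpart (partitionU dXL PS1 PS2) PS2 /=.
  rewrite (noncrossingU uXL PS1 PS2) andbC.
  apply/andP/andP => [[/open_atP[B [BP XB BL]] /andP[_ ->]]|[/eqP eP ->]].
    split=> //; have XP : X \in P1.
      move: BP; rewrite inE => /orP[BP|BP]; last first.
        have /set0Pn[x xX] := X0; have := subsetP XB x xX => xB.
        by have := disjointFr BL xB; rewrite (subsetP (partition_sub PS2 BP)).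
      suff <- : B = X by [].
      by apply/eqP; rewrite eqEsubset (partition_sub PS1 BP).
    rewrite eqEsubset sub1set XP andbT; apply/subsetP => V VP; rewrite inE.
    have /set0Pn[x xV] := partition_neq0 PS1 VP.
    have xX := subsetP (partition_sub PS1 VP) x xV.
    by rewrite (partition_eq PS1 VP XP xV xX).
  rewrite eP; split.
    by apply/open_atP; exists X; rewrite !inE eqxx.
  rewrite andbT; apply/noncrossingP => V W; rewrite !inE => /eqP-> /eqP->.
  by rewrite eqxx.
- move=> P1 P2 /eqP-> /andP[PS2 _].
  have PS1 := partition_set1 X0.
  have XP2 : X \notin P2.
    apply/negP => XP; have /set0Pn[x xX] := X0.
    by have := disjointFr dXL xX; rewrite (subsetP (partition_sub PS2 XP)).
  rewrite /weight big_setU1 //=; congr (_ * _); last first.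
    by apply: eq_bigr => V VP; rewrite (coveredUr uXL PS1 PS2).
  (* A block covering [X] would have a point before all of [X], but the points of [L] come after
     [X]. *)
  rewrite ifN //; apply/negP => /coveredP[W [i [k [WP iW _ H]]]].
  have /set0Pn[x xX] := X0.
  have := subsetP (partition_sub (partitionU dXL PS1 PS2) WP) i iW.
  rewrite inE => /orP[iX|iL].
    by have [] := H _ iX; rewrite prec_irr.
  by have [ix _] := H _ xX; apply: prec_asym ix (XL _ _ xX iL).
Qed.

End PartitionSums.

(** * One step of the scan *)

Section OpenStep.
Variables (K : comNzRingType) (n : nat) (chi : {ffun 'I_n -> face}).
Variables f g : {set 'I_n} -> K.
Implicit Types (P : {set {set 'I_n}}) (V W X L S : {set 'I_n}) (i j : 'I_n).

(** When the open block takes [c], the stretch [L] is enclosed between a point of [X] and [c]. Every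
    other block then lies inside [L] or avoids it, and those inside [L] are all covered, which is
    why their sum carries [f] in both places. *)
Let joined X L S c :
  X != set0 -> before chi X L -> before chi L S -> c \in S ->
  before chi [set c] (S :\ c) ->
  \sum_(P | ncpart chi (X :|: L :|: S) P && open_at (c |: X) L P)
    weight chi f g P =
  ncsum chi f f L * opensum chi f g (c |: X) set0 (S :\ c).
Proof.
move=> /set0Pn[x0 x0X] XL LS cS cmin.
pose H := (c |: X) :|: (S :\ c).
have eS : X :|: L :|: S = L :|: H.
  apply/setP => x; rewrite !inE; have [->|_] := eqVneq x c.
    by rewrite cS !orbT.
  by rewrite /= orbAC orbC orbA.
have dLH : [disjoint L & H].
  rewrite disjoint_sym disjoint_subset; apply/subsetP => x; rewrite !inE => xH.
  apply/negP => xL.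
  case/orP: xH => [/orP[|xX]|/andP[_ xS]].
  - by move=> /eqP ex; have := LS _ _ xL cS; rewrite ex prec_irr.
  - by have := XL _ _ xX xL; rewrite prec_irr.
  - by have := LS _ _ xL xS; rewrite prec_irr.
have uLH : unsplit_by chi L H.
  move=> i k x iL kL; rewrite !inE => xH ix xk.
  case/orP: xH => [/orP[/eqP ex|xX]|/andP[_ xS]].
  - by rewrite ex in xk; apply: prec_asym xk (LS _ _ kL cS).
  - by apply: prec_asym ix (XL _ _ xX iL).
  - by apply: prec_asym xk (LS _ _ kL xS).
rewrite eS /opensum setU0 -/H; apply: (sum_partitionU dLH).
- move=> P /andP[/andP[PS /noncrossingP Pnc] /open_atP[B [BP XB BL]]].
  split=> // V VP; have cB : c \in B by rewrite (subsetP XB) // !inE eqxx.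
  have xB : x0 \in B by rewrite (subsetP XB) // !inE x0X orbT.
  have VLH := subsetP (partition_sub PS VP).
  have [eV|ne] := eqVneq V B.
    apply/orP; right; apply/subsetP => x xV; have := VLH x xV.
    by rewrite inE eV in xV *; rewrite (disjointFr BL xV).
  have [|/subsetPn[h hV hL]] := boolP (V \subset L); first by [].
  apply/subsetP => x xV; have := VLH x xV; rewrite inE => /orP[xL|//].
  have hH : h \in H by have := VLH h hV; rewrite inE (negPf hL).
  exfalso; move: hH; rewrite !inE => /orP[/orP[/eqP ex|hX]|/andP[hc hS]].
  - by rewrite ex in hV; rewrite (partition_eq PS VP BP hV cB) eqxx in ne.
  - have hB : h \in B by rewrite (subsetP XB) // !inE hX orbT.
    by rewrite (partition_eq PS VP BP hV hB) eqxx in ne.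
  (* A block meeting both [L] and the points beyond [c] crosses the open block: [x0], [x], [c], [h]
     occur in this order. *)
  - apply: (Pnc B V BP VP); first by rewrite eq_sym.
    apply/crossingP; exists x0, x, c, h; split=> //; split.
    + exact: XL.
    + exact: LS.
    + by apply: cmin; rewrite !inE ?eqxx ?hc.
- by move=> P /andP[].
- by move=> P /andP[/andP[]].
- move=> P1 P2 PS1 PS2; rewrite /ncpart (partitionU dLH PS1 PS2) PS1 PS2 /=.
  rewrite (noncrossingU uLH PS1 PS2) -andbA; congr (_ && (_ && _)).
  apply/open_atP/open_atP => -[B [BP XB BL]]; last first.
    exists B; rewrite inE BP orbT; split=> //; rewrite disjoint_sym.
    by apply: disjointWr dLH; apply: partition_sub PS2 BP.
  exists B; split=> //; last by rewrite disjoints_subset setC0 subsetT.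
  move: BP; rewrite inE => /orP[BP|//].
  have xB : x0 \in B by rewrite (subsetP XB) // !inE x0X orbT.
  by have := disjointFr BL xB; rewrite (subsetP (partition_sub PS1 BP)).
- move=> P1 P2 /andP[PS1 _] /andP[/andP[PS2 _] /open_atP[B [BP XB _]]].
  have dP : [disjoint P1 & P2].
    rewrite disjoint_subset; apply/subsetP => V VP1; rewrite inE; apply/negP => VP2.
    have /set0Pn[x xV] := partition_neq0 PS1 VP1.
    have := disjointFr dLH (subsetP (partition_sub PS1 VP1) x xV).
    by rewrite (subsetP (partition_sub PS2 VP2)).
  rewrite /weight (eq_bigl [predU P1 & P2]); last by move=> V; rewrite !inE.
  rewrite bigU //=; congr (_ * _); apply: eq_bigr => V VP; last first.
    by rewrite (coveredUr uLH PS1 PS2).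
  rewrite if_same ifT //; apply/coveredP; exists B, x0, c; split.
  + by rewrite inE BP orbT.
  + by rewrite (subsetP XB) // !inE x0X orbT.
  + by rewrite (subsetP XB) // !inE eqxx.
  + move=> v /(subsetP (partition_sub PS1 VP)) vL.
    by split; [apply: XL | apply: LS].
Qed.

(** Either the open block takes [c], and [joined] splits off [L], or it skips [c], which then
    extends the passed stretch. *)
Lemma opensum_step X L S c :
  X != set0 -> before chi X L -> before chi L S -> c \in S ->
  before chi [set c] (S :\ c) ->
  opensum chi f g X L S =
  ncsum chi f f L * opensum chi f g (c |: X) set0 (S :\ c)
  + opensum chi f g X (c |: L) (S :\ c).
Proof.
move=> X0 XL LS cS cmin; rewrite -(joined X0 XL LS cS cmin).
rewrite {1}/opensum (bigID (open_at (c |: X) L)) /=; congr (_ + _).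
  apply: eq_bigl => P; rewrite -andbA; congr (_ && _); apply/andb_idl.
  case/open_atP=> B [BP XB BL]; apply/open_atP; exists B; split=> //.
  by apply: subset_trans XB; apply: subsetUr.
have eS : X :|: (c |: L) :|: (S :\ c) = X :|: L :|: S.
  apply/setP => x; rewrite !inE; have [->|_ //] := eqVneq x c.
  by rewrite cS !orbT.
rewrite /opensum eS; apply: eq_bigl => P.
rewrite -andbA; apply: andb_id2l => /andP[PS _].
have /set0Pn[x0 x0X] := X0.
apply/andP/open_atP => [[/open_atP[B [BP XB BL]] nc]|[B [BP XB BL]]].
  exists B; split=> //; rewrite disjoint_subset; apply/subsetP => x xB.
  rewrite !inE negb_or (disjointFr BL xB) andbT; apply: contra nc => /eqP ex.
  apply/open_atP; exists B; split=> //.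
  by rewrite subUset sub1set -ex xB.
split.
  apply/open_atP; exists B; split=> //; apply: disjointWr BL; apply: subsetUr.
apply/negP => /open_atP[B' [BP' XB' _]].
have x0B' : x0 \in B' by rewrite (subsetP XB') // !inE x0X orbT.
have cB : c \in B.
  rewrite (partition_eq PS BP BP' (subsetP XB _ x0X) x0B').
  by rewrite (subsetP XB') // !inE eqxx.
by have := disjointFr BL cB; rewrite !inE eqxx.
Qed.

End OpenStep.

(** * Reduction to words of faces *)

Definition isl (s : face) : bool := if s is lface then true else false.

Lemma card_sepU1 (T : finType) (p : pred T) c (X : {set T}) : c \notin X ->
  #|[set i in c |: X | p i]| = (#|[set i in X | p i]| + p c)%N.
Proof.
move=> cX; rewrite [RHS]addnC; have [pc|pc] := boolP (p c).
  have -> : [set i in c |: X | p i] = c |: [set i in X | p i].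
    by apply/setP => i; rewrite !inE; case: eqP => [->|].
  by rewrite cardsU1 inE (negPf cX).
congr #|pred_of_set _|; apply/setP => i; rewrite !inE.
by case: eqP => [->|//]; rewrite (negPf pc) (negPf cX).
Qed.

Section Counting.
Variables (n : nat) (chi : {ffun 'I_n -> face}).
Implicit Types (V W X L S : {set 'I_n}) (i j c : 'I_n).

Definition lcount V := #|[set i in V | isl (chi i)]|.
Definition rcount V := #|[set i in V | ~~ isl (chi i)]|.

Lemma lcountU1 c X : c \notin X -> lcount (c |: X) = (lcount X + isl (chi c))%N.
Proof. exact: card_sepU1. Qed.

Lemma rcountU1 c X : c \notin X -> rcount (c |: X) = (rcount X + ~~ isl (chi c))%N.
Proof. exact: card_sepU1. Qed.

Lemma lcount0 : lcount set0 = 0%N.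
Proof. by apply/eqP; rewrite cards_eq0; apply/eqP/setP => i; rewrite !inE. Qed.

Lemma rcount0 : rcount set0 = 0%N.
Proof. by apply/eqP; rewrite cards_eq0; apply/eqP/setP => i; rewrite !inE. Qed.

Lemma lrcountE V : (lcount V + rcount V)%N = #|V|.
Proof.
rewrite -(cardsID [set i | isl (chi i)] V); congr addn; apply: eq_card => i;
  by rewrite !inE // andbC.
Qed.

Definition prec_enum V : seq 'I_n :=
  [seq i <- enum 'I_n | (i \in V) && isl (chi i)] ++
  rev [seq i <- enum 'I_n | (i \in V) && ~~ isl (chi i)].

Lemma mem_prec_enum V : prec_enum V =i V.
Proof.
move=> i; rewrite mem_cat mem_rev !(mem_filter _ _ (enum 'I_n)) mem_enum !andbT -andb_orr.
by rewrite orbN andbT.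
Qed.

(** Left points come first in the order [prec], so the word of faces of a set is determined by its
    two counts, and hence so is every sum computed by scanning that word. *)
Lemma map_prec_enum V :
  [seq isl (chi i) | i <- prec_enum V] = nseq (lcount V) true ++ nseq (rcount V) false.
Proof.
have const b (s : seq 'I_n) : all (fun i => isl (chi i) == b) s ->
    [seq isl (chi i) | i <- s] = nseq (size s) b.
  by elim: s => //= i s IH /andP[/eqP-> /IH->].
rewrite map_cat (const true) ?(const false).
- have size_p (p : pred 'I_n) : size [seq i <- enum 'I_n | p i] = #|[set i | p i]|.
    rewrite -(card_uniqP (filter_uniq _ (enum_uniq _))); apply: eq_card => i.
    by rewrite (mem_filter _ _ (enum 'I_n)) mem_enum andbT inE.
  by rewrite size_rev !size_p.
- by rewrite all_rev; apply/allP => i; rewrite mem_filter => /andP[/andP[_ /negPf->]].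
- by apply/allP => i; rewrite mem_filter => /andP[/andP[_ ->]].
Qed.

Lemma pairwise_prec_enum V : pairwise (prec chi) (prec_enum V).
Proof.
have pw (p : pred 'I_n) : pairwise (fun i j : 'I_n => (i < j)%N) [seq i <- enum 'I_n | p i].
  rewrite -sorted_pairwise; last by move=> ? ? ?; apply: ltn_trans.
  apply: sorted_filter; first by move=> ? ? ?; apply: ltn_trans.
  by have := iota_ltn_sorted 0 n; rewrite -val_enum_ord sorted_map.
rewrite pairwise_cat; apply/and3P; split.
- apply/allrelP => i j; rewrite mem_rev !mem_filter.
  by rewrite /prec; case: (chi i); case: (chi j); rewrite ?andbF.
- apply: (sub_in_pairwise (P := fun i => isl (chi i))) (pw _).
    by move=> i j; rewrite /in_mem /= /prec; case: (chi i); case: (chi j).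
  by rewrite all_filter; apply/allP => i _; apply/implyP => /andP[].
- rewrite -sorted_pairwise ?rev_sorted; last exact: prec_trans.
  rewrite sorted_pairwise; last by move=> j i k ji kj; apply: prec_trans kj ji.
  apply: (sub_in_pairwise (P := fun i => ~~ isl (chi i))) (pw _).
    by move=> i j; rewrite /in_mem /= /prec; case: (chi i); case: (chi j).
  by rewrite all_filter; apply/allP => i _; apply/implyP => /andP[].
Qed.

End Counting.

Section Words.
Variable K : comNzRingType.
Implicit Types (f g M F : nat -> nat -> K).

Definition count_weight n (chi : {ffun 'I_n -> face}) g (V : {set 'I_n}) : K :=
  g (lcount chi V) (rcount chi V).

(* [opensum X L S], where [X] has [p] left and [q] right points, [L] has [a]
   and [b], and [s] is the word of faces of [S], [true] being left. *)
Fixpoint openword g M F (p q a b : nat) (s : seq bool) : K :=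
  if s is c :: s' then
    M a b * openword g M F (p + c) (q + ~~ c) 0 0 s'
    + openword g M F p q (a + c) (b + ~~ c) s'
  else g p q * F a b.

Section Fixed.
Variables (n : nat) (chi : {ffun 'I_n -> face}) (f g M F : nat -> nat -> K).
Implicit Types (V W X L S : {set 'I_n}).
Let wf := count_weight chi f.
Let wg := count_weight chi g.
Let computed L :=
  ncsum chi wf wf L = M (lcount chi L) (rcount chi L) /\
  ncsum chi wf wg L = F (lcount chi L) (rcount chi L).

(** Induction on the word, one [opensum_step] per letter. The size bound in the last hypothesis is
    the one that persists: a passed stretch can absorb at most the letters still unread. *)
Lemma opensum_word (s : seq 'I_n) X L :
  X != set0 -> before chi X L -> before chi X [set i in s] ->
  before chi L [set i in s] -> pairwise (prec chi) s ->
  (forall L', (#|L'| <= #|L| + size s)%N -> computed L') ->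
  opensum chi wf wg X L [set i in s] =
  openword g M F (lcount chi X) (rcount chi X) (lcount chi L) (rcount chi L)
    [seq isl (chi i) | i <- s].
Proof.
elim: s X L => [|c s IH] X L X0 XL Xs Ls /= ps H.
  have -> : [set i in [::]] = set0 :> {set 'I_n} by apply/setP => i; rewrite !inE.
  by rewrite opensum_close // (H _ _).2 // leq_addr.
case/andP: ps => /allP cs ps.
have cns : c \notin s by apply/negP => /cs; rewrite prec_irr.
have es : [set i in c :: s] :\ c = [set i in s].
  by apply/setP => i; rewrite !inE; case: eqP => // ->; rewrite (negPf cns).
have cS : c \in [set i in c :: s] by rewrite !inE eqxx.
have cX : c \notin X by apply/negP => cX; have := Xs _ _ cX cS; rewrite prec_irr.
have cL : c \notin L by apply/negP => cL; have := Ls _ _ cL cS; rewrite prec_irr.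
have cmin : before chi [set c] [set i in s].
  by move=> x y; rewrite !inE => /eqP-> /cs.
have subs x : x \in [set i in s] -> x \in [set i in c :: s].
  by rewrite !inE => ->; rewrite orbT.
rewrite (opensum_step _ _ X0 XL Ls cS) es //.
have [HM _] := H L (leq_addr _ _); rewrite HM.
rewrite (IH (c |: X) set0) //; first last.
- move=> L' L's; apply: H; rewrite cards0 in L's; apply: leq_trans L's _.
  by rewrite addnS leqW // leq_addl.
- by move=> x y; rewrite inE.
- move=> x y; rewrite inE => /orP[xc ys|xX /subs ys]; first exact: cmin.
  exact: Xs.
- by move=> x y _; rewrite inE.
- by apply/set0Pn; exists c; rewrite !inE eqxx.
rewrite (IH X (c |: L)) //; first last.
- move=> L' L's; apply: H; apply: leq_trans L's _.
  by rewrite cardsU1 cL addSnnS.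
- move=> x y; rewrite inE => /orP[xc ys|xL /subs ys]; first exact: cmin.
  exact: Ls.
- by move=> x y xX /subs; apply: Xs.
- move=> x y xX; rewrite inE => /orP[|]; last exact: XL.
  by rewrite inE => /eqP->; apply: Xs.
by rewrite !lcountU1 // !rcountU1 // lcount0 rcount0.
Qed.

(** The first letter opens the first block, so the scan starts from the counts (1, 0) or (0, 1) with
    one letter fewer. *)
Definition momentword g M F m k : K :=
  match m, k with
  | m'.+1, _ => openword g M F 1 0 0 0 (nseq m' true ++ nseq k false)
  | 0, k'.+1 => openword g M F 0 1 0 0 (nseq k' false)
  | 0, 0 => 1
  end.

(** The first point of [L] belongs to the open block and never to a passed stretch, so only sums
    over strictly smaller sets enter. This makes the recursion well founded. *)
Lemma ncsum_word L : (forall L', (#|L'| < #|L|)%N -> computed L') ->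
  ncsum chi wf wg L = momentword g M F (lcount chi L) (rcount chi L).
Proof.
have := map_prec_enum chi L; have := pairwise_prec_enum chi L.
have := mem_prec_enum chi L; case: (prec_enum chi L) => [|c s] /= memL.
  have -> : L = set0 by apply/setP => i; rewrite -memL inE.
  by move=> _; rewrite ncsum0 lcount0 rcount0.
case/andP=> /allP cs ps; have cns : c \notin s by apply/negP => /cs; rewrite prec_irr.
have cL : c \in L by rewrite -memL inE eqxx.
have eL : L :\ c = [set i in s].
  apply/setP => i; rewrite !inE -memL inE.
  by case: eqP => // ->; rewrite (negPf cns).
have zL : (size s < #|L|)%N.
  rewrite (cardsD1 c) cL eL ltnS; have /pairwise_uniq us := ps.
  by rewrite cardsE (card_uniqP _) // us // => i; rewrite prec_irr.
move=> e H; rewrite (ncsum_open _ _ _ cL) eL opensum_word //.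
- have eX : [set c] = c |: set0 by rewrite setU0.
  rewrite eX lcountU1 ?rcountU1 ?inE // !lcount0 !rcount0 /=.
  case: (lcount chi L) e => [|m] /=.
    by case: (rcount chi L) => [//|k] /= [-> ->].
  by case=> -> ->.
- by apply/set0Pn; exists c; rewrite inE.
- by move=> x y _; rewrite inE.
- by move=> x y; rewrite !inE => /eqP-> /cs.
- by move=> x y; rewrite inE.
- by move=> L'; rewrite cards0 => L's; apply: H; apply: leq_ltn_trans zL.
Qed.

End Fixed.

Variables (f g M F : nat -> nat -> K).
Hypotheses
  (HM : forall m k, M m k =
     ncsum (chi_mn m k) (count_weight (chi_mn m k) f) (count_weight (chi_mn m k) f) setT)
  (HF : forall m k, F m k =
     ncsum (chi_mn m k) (count_weight (chi_mn m k) f) (count_weight (chi_mn m k) g) setT).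

Lemma lcount_chi_mn m k : lcount (chi_mn m k) setT = m.
Proof.
rewrite /lcount -[RHS](card_ord m) -(card_imset predT (@lshift_inj m k)).
apply: eq_card => i; rewrite inE inE /= ffunE -(splitK i).
case: (split i) => j /=.
  by rewrite ltn_ord mem_imset //; apply: lshift_inj.
rewrite ltnNge leq_addr /=; apply/esym/negbTE/imsetP => -[j' _ /eqP].
by rewrite eq_rlshift.
Qed.

Lemma rcount_chi_mn m k : rcount (chi_mn m k) setT = k.
Proof.
by apply/eqP; rewrite -(eqn_add2l m) -{1}(lcount_chi_mn m k) lrcountE cardsT card_ord.
Qed.

Let computed n (chi : {ffun 'I_n -> face}) L :=
  ncsum chi (count_weight chi f) (count_weight chi f) L =
    M (lcount chi L) (rcount chi L) /\
  ncsum chi (count_weight chi f) (count_weight chi g) L =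
    F (lcount chi L) (rcount chi L).

(** By [ncsum_word] the sum over [L] and the sum over all of [chi_mn m k], with the counts of [L],
    are the same [momentword]. The induction on the size runs over all [n] and [chi] at once, since
    the comparison leaves the given [chi]. *)
Lemma ncsum_count n (chi : {ffun 'I_n -> face}) L : computed chi L.
Proof.
have [N] := ubnP #|L|; elim: N n chi L => // N IH n chi L LN.
have IH' (L' : {set 'I_n}) : (#|L'| < #|L|)%N -> computed chi L'.
  by move=> L'L; apply: IH; apply: leq_trans L'L _.
pose m := lcount chi L; pose k := rcount chi L.
have IHT (L' : {set 'I_(m + k)}) : (#|L'| < #|[set: 'I_(m + k)]|)%N -> computed (chi_mn m k) L'.
  have -> : #|[set: 'I_(m + k)]| = #|L| by rewrite cardsT card_ord lrcountE.
  by move=> L'L; apply: IH; apply: leq_trans L'L _.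
split.
  rewrite HM (ncsum_word (M := M) (F := M)); last by move=> L' /IH'[].
  rewrite (ncsum_word (M := M) (F := M)); last by move=> L' /IHT[].
  by rewrite lcount_chi_mn rcount_chi_mn.
rewrite HF (ncsum_word (M := M) (F := F)) //.
by rewrite (ncsum_word (M := M) (F := F)) // lcount_chi_mn rcount_chi_mn.
Qed.

Lemma momentwordE m k : F m k = momentword g M F m k.
Proof.
rewrite HF (ncsum_word (M := M) (F := F)) ?lcount_chi_mn ?rcount_chi_mn //.
by move=> L' _; apply: ncsum_count.
Qed.

End Words.

(** * From the moment-cumulant formulas to sums over words *)

Lemma nth_lt_count (s : seq nat) (m i : nat) : sorted ltn s -> (i < size s)%N ->
  (nth 0%N s i < m)%N = (i < count (fun x => x < m) s)%N.
Proof.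
elim: s i => // x s IH i /= xs; have ss := path_sorted xs.
have [xm|mx] := ltnP x m; first by case: i => [|i] //= /IH->.
have /allP/= ax := order_path_min ltn_trans xs.
have mcount : count (fun x => x < m)%N s = 0%N.
  apply/eqP; rewrite -leqn0 leqNgt -has_count; apply/hasPn => y /ax xy.
  by rewrite -leqNgt (leq_trans mx) // ltnW.
rewrite mcount ltn0 => isz; apply/negbTE; rewrite -leqNgt.
case: i isz => //= i isz; apply: leq_trans mx _; apply/ltnW/ax.
exact: mem_nth.
Qed.

Section Linking.
Variables (K : comNzRingType) (A : algType K) (al ar : A).

Definition arg_mn m n : {ffun 'I_(m + n) -> A} :=
  [ffun i : 'I_(m + n) => if (i < m)%N then al else ar].

Lemma prod_arg_mn m n : \prod_(i < m + n) arg_mn m n i = al ^+ m * ar ^+ n.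
Proof.
rewrite big_split_ord /=; congr (_ * _).
  rewrite (eq_bigr (fun=> al)); first by rewrite prodr_const card_ord.
  by move=> i _; rewrite ffunE /= ltn_ord.
rewrite (eq_bigr (fun=> ar)); first by rewrite prodr_const card_ord.
by move=> i _; rewrite ffunE /= ltnNge leq_addr.
Qed.

Lemma isl_chi_mn m n i : isl (chi_mn m n i) = (i < m)%N.
Proof. by rewrite ffunE; case: ifP. Qed.

(** In an increasing enumeration the entries below [m] form an initial segment. Thus [chi_mn]
    restricted to a block is again of the form [chi_mn], and its cumulant is a [bi_cumulant]. *)
Lemma enum_val_chi_mn m n (V : {set 'I_(m + n)}) (i : 'I_#|V|) :
  (enum_val i < m)%N = (i < lcount (chi_mn m n) V)%N.
Proof.
rewrite /enum_val -(nth_map _ 0%N) -?cardE ?ltn_ord // nth_lt_count.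
- congr (_ < _)%N; rewrite count_map -size_filter /lcount.
  have /card_uniqP <- := filter_uniq (fun j : 'I_(m + n) => j < m)%N (enum_uniq (mem V)).
  apply: eq_card => j.
  by rewrite (mem_filter _ _ (enum V)) mem_enum inE isl_chi_mn andbC.
- rewrite sorted_map; apply: sorted_filter; first by move=> ? ? ?; apply: ltn_trans.
  have := iota_ltn_sorted 0 (m + n); rewrite -val_enum_ord sorted_map.
  by rewrite enumT.
- by rewrite size_map -cardE ltn_ord.
Qed.

Lemma restr_chi_mn (G : cumulant_family A) m n (V : {set 'I_(m + n)}) :
  G #|V| (restr (chi_mn m n) V) (restr (arg_mn m n) V) =
  bi_cumulant G (lcount (chi_mn m n) V) (rcount (chi_mn m n) V) al ar.
Proof.
(* [#|V|] and the sum of the two counts are equal but not convertible; generalising over the length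
   lets the equality be substituted. *)
have cast N p q (e : N = (p + q)%N) (c : {ffun 'I_N -> face}) (b : {ffun 'I_N -> A}) :
    (forall i, c i = if (i < p)%N then lface else rface) ->
    (forall i, b i = if (i < p)%N then al else ar) ->
    G N c b = bi_cumulant G p q al ar.
  move: c b; rewrite {}e => c b Hc Hb; congr (G _ _ _); apply/ffunP => i.
    by rewrite ffunE Hc.
  by rewrite ffunE Hb.
apply: cast; first by rewrite lrcountE.
  by move=> i; rewrite !ffunE enum_val_chi_mn.
by move=> i; rewrite !ffunE enum_val_chi_mn.
Qed.

Lemma bi_cumulantl (G : cumulant_family A) m :
  bi_cumulant G m 0 al ar = free_cumulant G m al.
Proof.
rewrite /bi_cumulant /free_cumulant; move: (chi_mn m 0) (isl_chi_mn (m := m) (n := 0)).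
set b := [ffun i : 'I_(m + 0) => if (i < m)%N then al else ar].
have : forall i, b i = if (i < m)%N then al else ar by move=> i; rewrite ffunE.
move: b; rewrite addn0 => b Hb c Hc; congr (G _ _ _); apply/ffunP => i.
  by rewrite ffunE; have := Hc i; rewrite ltn_ord /isl; case: (c i).
by rewrite ffunE Hb ltn_ord.
Qed.

Lemma bi_cumulantr (G : cumulant_family A) n :
  bi_cumulant G 0 n al ar = G n [ffun=> rface] [ffun=> ar].
Proof.
by rewrite /bi_cumulant; congr (G _ _ _); apply/ffunP => i; rewrite !ffunE.
Qed.

(** The blocks are separated by [interior], which agrees with [covered] on a partition, and
    [restr_chi_mn] turns each factor into a function of the counts. *)
Lemma c_lr_ncsum (phi : A -> K) (kappa Kc : cumulant_family A) :
  is_c_lr_cumulants phi kappa Kc -> forall m n, (0 < m + n)%N ->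
  phi (al ^+ m * ar ^+ n) =
  ncsum (chi_mn m n)
    (count_weight (chi_mn m n) (fun p q => bi_cumulant kappa p q al ar))
    (count_weight (chi_mn m n) (fun p q => bi_cumulant Kc p q al ar)) setT.
Proof.
move=> [_ H] m n mn; rewrite -prod_arg_mn (H _ (chi_mn m n)) //.
apply: eq_big => [P|P]; first by rewrite inE.
rewrite inE => /andP[PS _].
rewrite [RHS](bigID (interior (chi_mn m n) P)) /=; congr (_ * _);
  apply: eq_bigr => V /andP[VP iV]; rewrite restr_chi_mn /count_weight;
  by rewrite -(interiorE _ PS VP) ?iV ?(negPf iV).
Qed.

Lemma lr_ncsum (psi : A -> K) (kappa : cumulant_family A) :
  is_lr_cumulants psi kappa -> forall m n, (0 < m + n)%N ->
  psi (al ^+ m * ar ^+ n) =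
  ncsum (chi_mn m n)
    (count_weight (chi_mn m n) (fun p q => bi_cumulant kappa p q al ar))
    (count_weight (chi_mn m n) (fun p q => bi_cumulant kappa p q al ar)) setT.
Proof.
move=> [_ H] m n mn; rewrite -prod_arg_mn (H _ (chi_mn m n)) //.
apply: eq_big => [P|P _]; first by rewrite inE.
by apply: eq_bigr => V _; rewrite restr_chi_mn if_same.
Qed.

End Linking.

(** * Power series *)

Lemma fpsCM (R : comNzRingType) (c : R) (f : fps R) n : (fpsC c * f) n = c * f n.
Proof.
by rewrite fpsME big_ord_recl /= subn0 big1 ?addr0 // => i _; rewrite mul0r.
Qed.

Lemma fpsXM (R : comNzRingType) (f : fps R) n :
  (fpsX R * f) n = if n is n'.+1 then f n' else 0.
Proof.
case: n => [|n]; rewrite fpsME big_ord_recl /= mul0r add0r; first by rewrite big_ord0.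
rewrite big_ord_recl /= mul1r subSS subn0 big1 ?addr0 // => i _.
by rewrite /= mul0r.
Qed.

Section BivariateCoefficients.
Variable K : fieldType.
Implicit Types (f : fps (fps K)) (u v : fps K).

Lemma fps2P f (g : fps (fps K)) : (forall m n, f m n = g m n) -> f = g.
Proof. by move=> fg; apply/fpsP => m; apply/fpsP => n. Qed.

Definition const2 (c : K) : fps (fps K) := fpsC (fpsC c).
Definition series2 (h : nat -> nat -> K) : fps (fps K) :=
  Fps (fun m => Fps (fun n => h m n)).

Lemma const2M c f m n : (const2 c * f) m n = c * f m n.
Proof. by rewrite fpsCM fpsCM. Qed.

Lemma varzM f m n : (varz K * f) m n = if m is m'.+1 then f m' n else 0.
Proof. by rewrite fpsXM; case: m. Qed.

Lemma varwM f m n : (varw K * f) m n = if n is n'.+1 then f m n' else 0.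
Proof. by rewrite fpsCM fpsXM. Qed.

Lemma in_zM u f m n : (in_z u * f) m n = \sum_(i < m.+1) u i * f (m - i)%N n.
Proof. by rewrite fpsME fps_sumE; apply: eq_bigr => i _; rewrite fpsCM. Qed.

Lemma in_wM u f m n : (f * in_w u) m n = \sum_(i < n.+1) f m i * u (n - i)%N.
Proof. by rewrite mulrC fpsCM mulrC fpsME. Qed.

Lemma in_zE u m n : in_z u m n = if n == 0%N then u m else 0.
Proof. by []. Qed.

Lemma in_wE u m n : in_w u m n = if m == 0%N then u n else 0.
Proof. by rewrite /in_w /=; case: eqP. Qed.

Lemma varz_in_zM u f m n :
  (varz K * (in_z u * f)) m n = \sum_(i < m) u i * f (m - i.+1)%N n.
Proof.
case: m => [|m]; first by rewrite varzM big_ord0.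
by transitivity ((in_z u * f) m n); [exact: varzM | exact: in_zM].
Qed.

Lemma varw_in_wM u f m n :
  (varw K * (f * in_w u)) m n = \sum_(i < n) f m i * u (n - i.+1)%N.
Proof.
case: n => [|n]; first by rewrite varwM big_ord0.
by transitivity ((f * in_w u) m n); [exact: varwM | exact: in_wM].
Qed.

(** A multiple of [u ^+ N] has no term of total degree below [N]. *)
Lemma adic_eq0 (u x : fps (fps K)) :
  u 0%N 0%N = 0 -> (forall N, exists d, x = u ^+ N * d) -> x = 0.
Proof.
move=> u0 ux; apply: fps2P => i j; have [d ->] := ux (i + j).+1.
rewrite fps2ME big1 // => -[a /= ai] _; rewrite big1 // => -[b /= bj] _.
have := @subst2_vanish K u 0 (i + j).+1 0 a b u0 erefl.
rewrite expr0 mulr1 addn0 => -> //; first by rewrite mul0r.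
by rewrite ltnS leq_add // -ltnS.
Qed.

(** The recursion climbs in [p] and has no initial value. Uniqueness is adic: unrolling [N] times
    exhibits the difference of two solutions as a multiple of [t ^+ N]. *)
Lemma rec_unique (t : fps (fps K)) (y x x' : nat -> fps (fps K)) :
  t 0%N 0%N = 0 ->
  (forall p, x p = y p + t * x p.+1) -> (forall p, x' p = y p + t * x' p.+1) ->
  forall p, x p = x' p.
Proof.
move=> t0 Hx Hx' p; apply/eqP; rewrite -subr_eq0; apply/eqP/(adic_eq0 t0) => N.
elim: N p => [|N IH] p; first by exists (x p - x' p); rewrite expr0 mul1r.
have [d Hd] := IH p.+1; exists d; rewrite exprS -mulrA -Hd Hx Hx'.
by rewrite opprD addrACA subrr add0r mulrBr.
Qed.

(* [u M] and [z] solve the same fixed point equation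
   [t = u (1 + k_1 t + k_2 t^2 + ...)]. *)
Lemma subordination (u z M : fps (fps K)) (k e c : nat -> fps (fps K)) :
  u 0%N 0%N = 0 -> (forall p, e p = k p + z * e p.+1) ->
  (forall p, c p = k p * M + u * M * c p.+1) ->
  M = 1 + u * c 1%N -> z = u * (1 + z * e 1%N) -> u * M = z.
Proof.
move=> u0 He Hc HM Hz; apply/eqP; rewrite -subr_eq0; apply/eqP.
apply: (adic_eq0 u0); elim=> [|N [d Hd]].
  by exists (u * M - z); rewrite expr0 mul1r.
(* If [u * M] were [z], then [M * e p] would satisfy the recursion of [c p]; the last summand is the
   resulting defect, divisible by [u ^+ N] by induction. *)
have Hb p : c p - M * e p = u * M * (c p.+1 - M * e p.+1) + (u * M - z) * M * e p.+1.
  by rewrite Hc He; ring.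
have Hbk j : (j <= N)%N -> forall p, exists d', c p - M * e p = u ^+ j * d'.
  elim: j => [_ p|j IH jN p]; first by exists (c p - M * e p); rewrite expr0 mul1r.
  have [d' Hd'] := IH (ltnW jN) p.+1.
  exists (M * d' + u ^+ (N - j.+1) * (d * M * e p.+1)).
  rewrite Hb Hd Hd' mulrDr exprS -{1}(subnKC jN) exprD exprS; ring.
have [d' Hd'] := Hbk N (leqnn N) 1%N.
exists (u * d' * (1 + z * e 1%N)).
(* This inverse allows the factor of [u * M - z] in [HtZ] to be cancelled. *)
have inv : (1 + z * e 1%N) * (1 - u * e 1%N) = 1.
  rewrite [in RHS](_ : 1 = 1 + z * e 1%N - u * (1 + z * e 1%N) * e 1%N).
    by ring.
  by rewrite -Hz; ring.
(* The right side has two factors [u] besides a multiple of [u ^+ N]; one of them advances the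
   induction and the other goes into the witness. *)
have HtZ : (u * M - z) * (1 - u * e 1%N) = u * u * (c 1%N - M * e 1%N).
  have Hzu : z * (1 - u * e 1%N) = u by rewrite {1}Hz -mulrA inv mulr1.
  rewrite mulrBl Hzu; transitivity (u * M - u - u * u * (M * e 1%N)); first by ring.
  by rewrite {1}HM; ring.
rewrite -[LHS]mulr1 -[X in _ * X = _]inv mulrCA HtZ Hd' exprS; ring.
Qed.

End BivariateCoefficients.

(** * Substitution of series without constant term *)

Section Substitution.
Variables (K : fieldType) (u v : fps (fps K)).
Hypotheses (u0 : u 0%N 0%N = 0) (v0 : v 0%N 0%N = 0).
Implicit Types f g : fps (fps K).
Let E f := subst2 f u v.

Let partial M N f := \sum_(m < M) \sum_(n < N) const2 (f m n) * (u ^+ m * v ^+ n).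

Let sum_widen k M (F : nat -> K) : (k <= M)%N ->
  (forall m, (k <= m)%N -> F m = 0) -> \sum_(m < k) F m = \sum_(m < M) F m.
Proof.
move=> kM F0; rewrite -(big_mkord xpredT F) -[RHS](big_mkord xpredT F).
rewrite (big_cat_nat _ kM) //= [X in _ = _ + X]big_nat_cond [X in _ = _ + X]big1.
  by rewrite addr0.
by move=> m /andP[/andP[/F0]].
Qed.

(** Terms beyond the cut-off do not reach the coefficient (i, j), by [subst2_vanish]. The two
    independent bounds leave room for a shift in one variable. *)
Lemma subst2_partial f M N i j : (i + j < M)%N -> (i + j < N)%N ->
  E f i j = partial M N f i j.
Proof.
move=> iM iN; rewrite /partial fps_sumE fps_sumE.
have van m n : (i + j < m + n)%N -> f m n * (u ^+ m * v ^+ n) i j = 0.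
  by move=> mn; rewrite subst2_vanish ?mulr0.
rewrite /E /subst2 /= (@sum_widen _ M (fun m =>
  \sum_(n < (i + j).+1) f m n * (u ^+ m * v ^+ n) i j)) //; last first.
  move=> m im; rewrite big1 // => n _; apply: van.
  by apply: leq_trans im _; apply: leq_addr.
apply: eq_bigr => m _; rewrite fps_sumE fps_sumE.
rewrite (@sum_widen _ N (fun n => f m n * (u ^+ m * v ^+ n) i j)) //; last first.
  by move=> n in_; apply: van; apply: leq_trans in_ _; apply: leq_addl.
by apply: eq_bigr => n _; rewrite const2M.
Qed.

Let mul_congr k (x f g : fps (fps K)) :
  (forall i j, (i + j < k)%N -> f i j = g i j) ->
  forall i j, (i + j < k)%N -> (x * f) i j = (x * g) i j.
Proof.
move=> fg i j ij; rewrite !fps2ME; apply: eq_bigr => a _; apply: eq_bigr => b _.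
by rewrite fg //; apply: leq_ltn_trans ij; apply: leq_add; apply: leq_subr.
Qed.

Lemma subst2D f g : E (f + g) = E f + E g.
Proof.
apply: fps2P => i j; rewrite /E /= -big_split; apply: eq_bigr => m _.
by rewrite -big_split; apply: eq_bigr => n _; rewrite /= mulrDl.
Qed.

Lemma subst2_const c f : E (const2 c * f) = const2 c * E f.
Proof.
apply: fps2P => i j; rewrite const2M /E /= mulr_sumr; apply: eq_bigr => m _.
by rewrite mulr_sumr; apply: eq_bigr => n _; rewrite const2M mulrA.
Qed.

Let shiftz (R : comNzRingType) (c x y : R) m :
  c * (x ^+ m.+1 * y) = x * (c * (x ^+ m * y)).
Proof. by rewrite exprS; ring. Qed.

Let shiftw (R : comNzRingType) (c x y : R) m :
  c * (y * x ^+ m.+1) = x * (c * (y * x ^+ m)).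
Proof. by rewrite exprS; ring. Qed.

Let const2_0 : const2 0 = 0 :> fps (fps K).
Proof. by apply: fps2P => a b; rewrite -[const2 0]mulr1 const2M mul0r. Qed.

Lemma subst2_varzM f : E (varz K * f) = u * E f.
Proof.
apply: fps2P => i j; pose N := (i + j).+1.
(* The extra row absorbs the shift by [varz], whose row 0 vanishes. *)
rewrite (@subst2_partial _ N.+1 N) ?leqnSn //.
rewrite (@mul_congr N u (E f) (partial N N f)) //; last first.
  by move=> a b ab; apply: subst2_partial.
congr (fps_coef (fps_coef _ i) j); rewrite /partial big_ord_recl /=.
rewrite [X in X + _]big1; last first.
  by move=> n _; rewrite varzM const2_0 mul0r.
rewrite add0r mulr_sumr; apply: eq_bigr => m _; rewrite mulr_sumr.
by apply: eq_bigr => n _; rewrite varzM; apply: shiftz.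
Qed.

Lemma subst2_varwM f : E (varw K * f) = v * E f.
Proof.
apply: fps2P => i j; pose N := (i + j).+1.
rewrite (@subst2_partial _ N N.+1) ?leqnSn //.
rewrite (@mul_congr N v (E f) (partial N N f)) //; last first.
  by move=> a b ab; apply: subst2_partial.
congr (fps_coef (fps_coef _ i) j); rewrite /partial mulr_sumr.
apply: eq_bigr => m _; rewrite big_ord_recl /= varwM const2_0 mul0r add0r mulr_sumr.
by apply: eq_bigr => n _; rewrite varwM; apply: shiftw.
Qed.

Lemma subst2_1 : E 1 = 1.
Proof.
apply: fps2P => i j; rewrite (@subst2_partial _ (i + j).+1 (i + j).+1) //.
congr (fps_coef (fps_coef _ i) j); rewrite /partial big_ord_recl big_ord_recl /=.
rewrite !expr0 !mulr1 big1 ?big1 ?addr0 //.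
- by move=> m _; rewrite big1 // => n _; apply: fps2P => a b; rewrite const2M mul0r.
- by move=> n _; apply: fps2P => a b; rewrite const2M mul0r.
Qed.

Let vanish_mul k (x f : fps (fps K)) : x 0%N 0%N = 0 ->
  (forall i j, (i + j < k)%N -> f i j = 0) ->
  forall i j, (i + j < k.+1)%N -> (x * f) i j = 0.
Proof.
move=> x0 f0 i j ij; rewrite fps2ME big1 // => -[a /= ai] _.
rewrite big1 // => -[b /= bj] _.
have [/andP[/eqP-> /eqP->]|ab] := boolP ((a == 0%N) && (b == 0%N)).
  by rewrite x0 mul0r.
rewrite f0 ?mulr0 //; rewrite ltnS in ai; rewrite ltnS in bj.
have ij' : (i + j = (a + b) + ((i - a) + (j - b)))%N.
  by rewrite addnACA !subnKC.
rewrite -ltnS; apply: leq_trans ij; rewrite ij' ltnS -[X in (X < _)%N]add0n.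
by rewrite ltn_add2r lt0n addn_eq0.
Qed.

Let decompose f : f = const2 (f 0%N 0%N) +
  (varz K * series2 (fun m n => f m.+1 n) + varw K * in_w (Fps (fun n => f 0%N n.+1))).
Proof.
apply: fps2P => m n; rewrite !fpsDE varzM varwM -[const2 _]mulr1 const2M !fps1E.
case: m n => [|m] [|n] /=; rewrite ?fps0E ?fps1E ?mulr0 ?mulr1 ?addr0 ?add0r //.
Qed.

(** Induction on the total degree, with the first factor written by [decompose] as a constant plus
    multiples of [varz] and [varw]. These become multiples of [u] and [v], which lack a constant
    term, so the remaining products are needed only in lower degree. *)
Lemma subst2M f g : E (f * g) = E f * E g.
Proof.
suff H k : forall f i j, (i + j < k)%N -> E (f * g) i j = (E f * E g) i j.
  by apply: fps2P => i j; apply: (H (i + j).+1).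
elim: k => // k IH {}f i j ij.
rewrite (decompose f); set c := f 0%N 0%N; set f1 := series2 _; set f2 := in_w _.
rewrite !mulrDl !subst2D -!mulrA !subst2_varzM !subst2_varwM.
rewrite subst2_const -[const2 c in X in _ = X]mulr1 subst2_const subst2_1 mulr1.
rewrite !mulrDl !fpsDE -!mulrA; congr (_ + (_ + _)).
  apply/eqP; rewrite -subr_eq0 -[_ - _]/((u * E (f1 * g) - u * (E f1 * E g)) i j).
  rewrite -mulrBr; apply/eqP/(vanish_mul u0 _ ij) => a b ab.
  by rewrite !fpsDE !fpsNE IH ?subrr.
apply/eqP; rewrite -subr_eq0 -[_ - _]/((v * E (f2 * g) - v * (E f2 * E g)) i j).
rewrite -mulrBr; apply/eqP/(vanish_mul v0 _ ij) => a b ab.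
by rewrite !fpsDE !fpsNE IH ?subrr.
Qed.

End Substitution.

(** * Functional equations *)

Section WordSeries.
Variables (K : fieldType) (g M F : nat -> nat -> K).

Definition openlr p q m n := openword g M F p q 0 0 (nseq m true ++ nseq n false).

(** The index [j] counts the right letters passed before one joins the open block; the last term is
    the case where none joins. *)
Lemma openword_r p q a b n :
  openword g M F p q a b (nseq n false) =
  \sum_(j < n) M a (b + j)%N * openlr p q.+1 0 (n - j.+1) + g p q * F a (b + n)%N.
Proof.
elim: n b => [|n IH] b /=; first by rewrite big_ord0 add0r addn0.
rewrite !addn0 !addn1 IH big_ord_recl /= addn0 subn1 addrA addSnnS; congr (_ + _ + _).
by apply: eq_bigr => j _; rewrite /bump /= addSnnS.
Qed.

Lemma openword_lr p q a b m n :
  openword g M F p q a b (nseq m true ++ nseq n false) =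
  \sum_(i < m) M (a + i)%N b * openlr p.+1 q (m - i.+1) n
  + openword g M F p q (a + m) b (nseq n false).
Proof.
elim: m a => [|m IH] a /=; first by rewrite big_ord0 add0r addn0.
rewrite !addn0 !addn1 IH big_ord_recl /= addn0 subn1 addrA addSnnS; congr (_ + _ + _).
by apply: eq_bigr => j _; rewrite /bump /= addSnnS.
Qed.

(** The open block has no further point, or its next point is a left one after [i] left points, or a
    right one after all [m] left and [j] right points. In the last case no left letter remains, so
    only a series in w is needed there. *)
Lemma openlrE p q m n : openlr p q m n =
  g p q * F m n + \sum_(i < m) M i 0%N * openlr p.+1 q (m - i.+1) n
  + \sum_(j < n) M m j * openlr p q.+1 0 (n - j.+1).
Proof.
by rewrite /openlr openword_lr openword_r add0n [in RHS]addrAC [in RHS]addrC [X in _ + X]addrC.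
Qed.

(** [open2 p q] is A_(p,q)(z,w), [openl p] is A_(p,0)(z,0) and [openr p q] is A_(p,q)(0,w). *)
Definition open2 p q := series2 (openlr p q).
Definition openl p := in_z (Fps (fun m => openlr p 0 m 0)).
Definition openr p q := in_w (Fps (fun n => openlr p q 0 n)).

Definition seriesl (h : nat -> nat -> K) := in_z (Fps (fun m => h m 0%N)).
Definition seriesr (h : nat -> nat -> K) := in_w (Fps (fun n => h 0%N n)).

Lemma open2E p q : open2 p q = const2 (g p q) * series2 F +
  varz K * (seriesl M * open2 p.+1 q) + varw K * (series2 M * openr p q.+1).
Proof.
apply: fps2P => m n; rewrite !fpsDE const2M varz_in_zM varw_in_wM.
exact: openlrE.
Qed.

Lemma openlE p : openl p = const2 (g p 0%N) * seriesl F +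
  varz K * (seriesl M * openl p.+1).
Proof.
apply: fps2P => m n; rewrite fpsDE const2M varz_in_zM !in_zE /=.
case: n => [|n] /=; first by rewrite openlrE big_ord0 addr0.
by rewrite mulr0 add0r big1 // => i _; rewrite mulr0.
Qed.

Lemma openrE p q : openr p q = const2 (g p q) * seriesr F +
  varw K * (seriesr M * openr p q.+1).
Proof.
apply: fps2P => m n; rewrite fpsDE const2M varw_in_wM !in_wE.
under eq_bigr do rewrite in_wE.
case: m => [|m] /=; first by rewrite openlrE big_ord0 addr0.
by rewrite mulr0 add0r big1 // => i _; rewrite mul0r.
Qed.

Hypothesis HF : forall m n, F m n = momentword g M F m n.

(** A word starts with a left letter unless it contains none. *)
Lemma series2E : series2 F = seriesr F + varz K * open2 1 0.
Proof.
apply: fps2P => m n; rewrite fpsDE varzM in_wE.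
by case: m => [|m] /=; rewrite ?addr0 // add0r HF.
Qed.

Lemma serieslE : seriesl F = 1 + varz K * openl 1.
Proof.
apply: fps2P => m n; rewrite fpsDE varzM in_zE fps1E.
case: m n => [|m] [|n] /=; rewrite ?fps1E ?fps0E ?addr0 ?add0r ?in_zE //; by rewrite HF.
Qed.

Lemma seriesrE : seriesr F = 1 + varw K * openr 0 1.
Proof.
apply: fps2P => m n; rewrite fpsDE varwM in_wE fps1E.
case: m n => [|m] [|n] /=; rewrite ?fps1E ?fps0E ?addr0 ?add0r ?in_wE //; by rewrite HF.
Qed.

End WordSeries.

(** * Solving the recursions after substitution *)

Section FunctionalEquations.
Variables (K : fieldType) (f g M F : nat -> nat -> K) (u v : fps (fps K)).
Hypotheses (HM : forall m n, M m n = momentword f M M m n)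
           (HF : forall m n, F m n = momentword g M F m n).
Hypotheses (u0 : u 0%N 0%N = 0) (v0 : v 0%N 0%N = 0).

Let E x := subst2 x u v.

(** These tails of cumulant series solve the substituted recursions. For cumulants, [tailz h 1] and
    [tailw h 0 1] are the one-variable R-transforms and [tail2 h 1] is the mixed part divided by
    zw. *)
Definition tailz (h : nat -> nat -> K) p := in_z (Fps (fun k => h (p + k)%N 0%N)).
Definition tailw (h : nat -> nat -> K) p q := in_w (Fps (fun k => h p (q + k)%N)).
Definition tail2 (h : nat -> nat -> K) p :=
  series2 (fun m n => h (p + m)%N n.+1).

Hypotheses (Hu : u * (1 + varz K * tailz f 1) = varz K)
           (Hv : v * (1 + varw K * tailw f 0 1) = varw K).

Lemma tailzE (h : nat -> nat -> K) p :
  tailz h p = const2 (h p 0%N) + varz K * tailz h p.+1.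
Proof.
apply: fps2P => m n; rewrite fpsDE varzM in_zE -[const2 _]mulr1 const2M fps1E.
case: m n => [|m] [|n] /=; rewrite ?fps1E ?fps0E ?mulr0 ?mulr1 ?addr0 ?addn0 ?add0r //.
by rewrite addSnnS.
Qed.

Lemma tailwE (h : nat -> nat -> K) p q :
  tailw h p q = const2 (h p q) + varw K * tailw h p q.+1.
Proof.
apply: fps2P => m n; rewrite fpsDE varwM in_wE -[const2 _]mulr1 const2M fps1E.
case: m n => [|m] [|n] /=; rewrite ?fps1E ?fps0E ?mulr0 ?mulr1 ?addr0 ?addn0 ?add0r //.
by rewrite addSnnS.
Qed.

Lemma tail2E (h : nat -> nat -> K) p :
  tail2 h p = tailw h p 1 + varz K * tail2 h p.+1.
Proof.
apply: fps2P => m n; rewrite fpsDE varzM in_wE.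
by case: m => [|m] /=; rewrite ?addr0 ?add0r ?addn0 ?add1n // addSnnS.
Qed.

Let ED x y : E (x + y) = E x + E y. Proof. exact: subst2D. Qed.
Let EM x y : E (x * y) = E x * E y. Proof. exact: subst2M. Qed.
Let EC c x : E (const2 c * x) = const2 c * E x. Proof. exact: subst2_const. Qed.
Let Ez x : E (varz K * x) = u * E x. Proof. exact: subst2_varzM. Qed.
Let Ew x : E (varw K * x) = v * E x. Proof. exact: subst2_varwM. Qed.
Let E1 : E 1 = 1. Proof. exact: subst2_1. Qed.

(** Instance of [subordination]: the substituted [openlE], with cumulants of psi for all blocks, is
    the equation for [c], and [tailzE] is the one for [e]. *)
Lemma subordinationl : u * E (seriesl M) = varz K.
Proof.
apply: (@subordination K u (varz K) _ (fun p => const2 (f p 0%N)) (tailz f)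
  (fun p => E (openl f M M p))) => // [p|p|]; first exact: tailzE.
- by rewrite {1}openlE ED EC Ez EM mulrA.
- by rewrite {1}(serieslE HM) ED E1 Ez.
Qed.

Lemma subordinationr : v * E (seriesr M) = varw K.
Proof.
apply: (@subordination K v (varw K) _ (fun p => const2 (f 0%N p)) (tailw f 0)
  (fun p => E (openr f M M 0 p))) => // [p|p|]; first exact: tailwE.
- by rewrite {1}openrE ED EC Ew EM mulrA.
- by rewrite {1}(seriesrE HM) ED E1 Ew.
Qed.

(** By [subordinationr] the multiplier in the recursion over [q] becomes w, and the right side
    satisfies the same recursion. *)
Let openr_subst p q : E (openr g M F p q) = E (seriesr F) * tailw g p q.
Proof.
apply: (@rec_unique K (varw K) (fun q => const2 (g p q) * E (seriesr F))
  (fun q => E (openr g M F p q))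
  (fun q => E (seriesr F) * tailw g p q)) => // {}q.
  by rewrite {1}openrE ED EC Ew EM mulrA subordinationr.
by rewrite {1}tailwE; ring.
Qed.

(** The multiplier becomes z by [subordinationl], and [openr_subst] evaluates the source term coming
    from blocks that go on to right points; [tail2] accumulates that term. *)
Let open2_subst p : E (open2 g M F p 0) =
  E (series2 F) * tailz g p + v * E (series2 M) * E (seriesr F) * tail2 g p.
Proof.
apply: (@rec_unique K (varz K) (fun p => const2 (g p 0%N) * E (series2 F)
    + v * E (series2 M) * E (seriesr F) * tailw g p 1)
  (fun p => E (open2 g M F p 0))
  (fun p => E (series2 F) * tailz g p
     + v * E (series2 M) * E (seriesr F) * tail2 g p)) => // {}p.
  rewrite {1}open2E !ED EC Ez EM mulrA subordinationl Ew EM openr_subst; ring.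
by rewrite {1}tailzE {1}tail2E; ring.
Qed.

Lemma c_moment_equation :
  (1 - u * tailz g 1) * (1 - v * tailw g 0 1) * E (series2 F) =
  1 + u * v * E (series2 M) * tail2 g 1.
Proof.
(* The one-variable c-free relation for the right face; it eliminates Phi(0,v) below. *)
have HFr : (1 - v * tailw g 0 1) * E (seriesr F) = 1.
  rewrite mulrBl mul1r {1}(seriesrE HF) ED E1 Ew openr_subst; ring.
transitivity ((1 - v * tailw g 0 1) *
  (E (series2 F) - u * (E (series2 F) * tailz g 1))); first by ring.
rewrite {1}(series2E HF) ED Ez open2_subst.
transitivity ((1 - v * tailw g 0 1) * E (seriesr F) *
  (1 + u * v * E (series2 M) * tail2 g 1)); first by ring.
by rewrite HFr mul1r.
Qed.

End FunctionalEquations.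

(** * The partial R-transform *)

Section PartialTransform.
Variables (K : fieldType) (A : algType K) (phi psi : {scalar A}).
Hypotheses (phi1 : phi 1 = 1) (psi1 : psi 1 = 1).
Variables (kappa Kc : cumulant_family A).
Hypotheses (kappaP : is_lr_cumulants psi kappa)
           (KcP : is_c_lr_cumulants phi kappa Kc).
Variables al ar : A.

Let f p q := bi_cumulant kappa p q al ar.
Let g p q := bi_cumulant Kc p q al ar.
Let moment (xi : A -> K) m n := xi (al ^+ m * ar ^+ n).

Let moment_psi m n : moment psi m n = ncsum (chi_mn m n)
  (count_weight (chi_mn m n) f) (count_weight (chi_mn m n) f) setT.
Proof.
case: m n => [|m] [|n]; try exact: lr_ncsum.
(* The moment-cumulant formula starts at length 1; for the empty word the sum is 1, which is
   [psi 1]. *)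
have -> : [set: 'I_(0 + 0)] = set0 by apply/setP => -[].
by rewrite ncsum0 /moment mulr1 psi1.
Qed.

Let moment_phi m n : moment phi m n = ncsum (chi_mn m n)
  (count_weight (chi_mn m n) f) (count_weight (chi_mn m n) g) setT.
Proof.
case: m n => [|m] [|n]; try exact: c_lr_ncsum.
have -> : [set: 'I_(0 + 0)] = set0 by apply/setP => -[].
by rewrite ncsum0 /moment mulr1 phi1.
Qed.

Let u := varz K / (1 + varz K * in_z (R_transform kappa al)).
Let v := varw K / (1 + varw K * in_w (R_transform kappa ar)).

Let unit_denl : 1 + varz K * in_z (R_transform kappa al) \is a GRing.unit.
Proof. by rewrite !fps_unitE fpsDE varzM addr0; apply: unitr1. Qed.

Let unit_denr : 1 + varw K * in_w (R_transform kappa ar) \is a GRing.unit.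
Proof. by rewrite !fps_unitE fpsDE varwM addr0; apply: unitr1. Qed.

Let uE : u * (1 + varz K * in_z (R_transform kappa al)) = varz K.
Proof. exact: divrK. Qed.

Let vE : v * (1 + varw K * in_w (R_transform kappa ar)) = varw K.
Proof. exact: divrK. Qed.

Let u00 : u 0%N 0%N = 0. Proof. exact: varzM. Qed.
Let v00 : v 0%N 0%N = 0. Proof. exact: varwM. Qed.

Let tail_kl : tailz f 1 = in_z (R_transform kappa al).
Proof. by congr in_z; apply/fpsP => k; apply: bi_cumulantl. Qed.

Let tail_kr : tailw f 0 1 = in_w (R_transform kappa ar).
Proof.
congr in_w; apply/fpsP => k; rewrite /= /f bi_cumulantr.
exact: lr_cumulants_const kappaP _.
Qed.

Let tail_Kl : tailz g 1 = in_z (R_transform Kc al).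
Proof. by congr in_z; apply/fpsP => k; apply: bi_cumulantl. Qed.

Let tail_Kr : tailw g 0 1 = in_w (R_transform Kc ar).
Proof.
congr in_w; apply/fpsP => k; rewrite /= /g bi_cumulantr.
exact: c_lr_cumulants_const kappaP KcP _.
Qed.

Let R2E : R_transform2 Kc al ar = varz K * in_z (R_transform Kc al)
  + varw K * in_w (R_transform Kc ar) + varz K * (varw K * tail2 g 1).
Proof.
rewrite -tail_Kl -tail_Kr; apply: fps2P => m n.
case: m n => [|m] [|n]; rewrite !fpsDE !varzM !varwM; cbv iota;
  by rewrite ?varwM /= ?fps0E ?addr0 ?add0r.
Qed.

Let cauchyE (xi : A -> K) : xi 1 = 1 ->
  cauchy_series xi al ar = varz K * (varw K * series2 (moment xi)).
Proof.
move=> xi1; apply: fps2P => m n; rewrite varzM.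
case: m => [|m]; first by [].
rewrite varwM; case: n => [|n]; first by case: m.
by case: m n => [|m] [|n] //=; rewrite /moment mulr1 xi1.
Qed.

Let cauchy2E (xi : A -> K) : xi 1 = 1 ->
  cauchy2 xi al ar ((in_z (R_transform kappa al))%:F + (varz K)%:F^-1)
    ((in_w (R_transform kappa ar))%:F + (varw K)%:F^-1) =
  u%:F * (v%:F * (subst2 (series2 (moment xi)) u v)%:F).
Proof.
move=> xi1; rewrite /cauchy2 /eval_inv inv_in_z inv_in_w !tofracK cauchyE //.
by rewrite (subst2_varzM u00 v00) (subst2_varwM u00 v00) !tofracM.
Qed.

Let subst_psi_neq0 : subst2 (series2 (moment psi)) u v != 0.
Proof.
have e : subst2 (series2 (moment psi)) u v 0%N 0%N = 1.
  have uv0 : u ^+ 0 * v ^+ 0 = 1 by rewrite !expr0 mulr1.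
  rewrite [LHS]big_ord1 big_ord1.
  transitivity (moment psi 0 0 * (u ^+ 0 * v ^+ 0) 0%N 0%N); first by [].
  have m00 : moment psi 0 0 = 1 by rewrite /moment mulr1 psi1.
  by rewrite uv0 m00 mul1r.
by apply/eqP => e0; move/eqP: e; rewrite e0 eq_sym oner_eq0.
Qed.

Let tofrac_equation (a b c d p q t : fps (fps K)) :
  (1 - a * c) * (1 - b * d) * p = 1 + a * b * q * t ->
  (1 - a%:F * c%:F) * (1 - b%:F * d%:F) * p%:F = 1 + a%:F * b%:F * q%:F * t%:F.
Proof.
move/(congr1 (fun h => h%:F)).
by rewrite !(tofracM, tofracD, tofracN, tofrac1, tofracB).
Qed.

Let partial_algebra (L : fieldType) (z w x y rl rr p q t : L) :
  x != 0 -> y != 0 -> q != 0 ->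
  (1 - x * rl) * (1 - y * rr) * p = 1 + x * y * q * t ->
  z * w * (- 1 + (x^-1 - rl) * (y^-1 - rr) * (x * (y * p))) / (x * (y * q)) =
  z * (w * t).
Proof.
move=> x0 y0 q0 H.
have -> : (x^-1 - rl) * (y^-1 - rr) * (x * (y * p)) =
    (1 - x * rl) * (1 - y * rr) * p by field; rewrite x0 y0.
by rewrite H; field; rewrite x0 y0 q0.
Qed.

Lemma partial_R_transform :
  let z : laurent2 K := (varz K)%:F in
  let w : laurent2 K := (varw K)%:F in
  let Rl : laurent2 K := (in_z (R_transform kappa al))%:F in
  let Rr : laurent2 K := (in_w (R_transform kappa ar))%:F in
  let Rcl : laurent2 K := (in_z (R_transform Kc al))%:F in
  let Rcr : laurent2 K := (in_w (R_transform Kc ar))%:F in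
  (R_transform2 Kc al ar)%:F = z * Rcl + w * Rcr +
    z * w * (- 1 + (Rl + z^-1 - Rcl) * (Rr + w^-1 - Rcr)
                   * cauchy2 phi al ar (Rl + z^-1) (Rr + w^-1))
    / cauchy2 psi al ar (Rl + z^-1) (Rr + w^-1).
Proof.
move=> z w Rl Rr Rcl Rcr; rewrite R2E !tofracD !tofracM !cauchy2E //.
have -> : Rl + z^-1 = u%:F^-1 by rewrite -[LHS]invrK inv_in_z.
have -> : Rr + w^-1 = v%:F^-1 by rewrite -[LHS]invrK inv_in_w.
have u_neq0 : u != 0.
  by apply: contraTneq (varz_neq0 K) => u0; rewrite -uE u0 mul0r eqxx.
have v_neq0 : v != 0.
  by apply: contraTneq (varw_neq0 K) => v0; rewrite -vE v0 mul0r eqxx.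
congr (_ + _); symmetry; apply: partial_algebra; rewrite ?tofrac_eq0 //.
have HM := momentwordE moment_psi moment_psi.
have HF := momentwordE moment_psi moment_phi.
apply: tofrac_equation; rewrite -tail_Kl -tail_Kr.
by apply: (c_moment_equation HM HF u00 v00); rewrite ?tail_kl ?tail_kr.
Qed.

End PartialTransform.

Theorem corollary5p7 (R : realType) (A : algType R[i])
    (phi psi : {scalar A}) (phi1 : phi 1 = 1) (psi1 : psi 1 = 1)
    (kappa Kc : cumulant_family A)
    (kappaP : is_lr_cumulants psi kappa)
    (KcP : is_c_lr_cumulants phi kappa Kc)
    (al ar : A) :
  let z : laurent2 R[i] := (varz R[i])%:F in
  let w : laurent2 R[i] := (varw R[i])%:F in
  let Rl : laurent2 R[i] := (in_z (R_transform kappa al))%:F in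
  let Rr : laurent2 R[i] := (in_w (R_transform kappa ar))%:F in
  let Rcl : laurent2 R[i] := (in_z (R_transform Kc al))%:F in
  let Rcr : laurent2 R[i] := (in_w (R_transform Kc ar))%:F in
  let Gphi := cauchy2 phi al ar in
  let Gpsi := cauchy2 psi al ar in
  let Rt : laurent2 R[i] :=
    z * w * (- 1 + (Rl + z^-1 - Rcl) * (Rr + w^-1 - Rcr)
                   * Gphi (Rl + z^-1) (Rr + w^-1))
    / Gpsi (Rl + z^-1) (Rr + w^-1) in
  (R_transform2 Kc al ar)%:F = z * Rcl + w * Rcr + Rt.
Proof. exact: partial_R_transform. Qed.
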